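(* Let $\epsilon>0$ and $$\tilde k=\Big\lceil\log_{\rho_\mu\zeta}\Big(\frac{\epsilon(1-\eta)(1-\rho_\mu\zeta)}{4u_M(1-\rho_\mu)}\Big)\Big\rceil .$$ Let $\phi_\epsilon$ be the (initial-state dependent) policy that uses the policy $\phi^{\tilde k}_{\epsilon/2}$ when the initial queue length is $i\le\tilde k$, and uses the policy $\phi_0$ when the initial queue length is $i>\tilde k$. Then $\phi_\epsilon$ is $\epsilon$-optimal for the initial queue length distribution $\pi_\mu$, i.e. its expected saved cost satisfies $$\sum_{i=0}^{\tilde k}\pi_\mu(i)\,s^{\phi^{\tilde k}_{\epsilon/2}}(\delta_i)+\sum_{i=\tilde k+1}^\infty\pi_\mu(i)\,s^{\phi_0}(\delta_i)\ \ge\ s(\pi_\mu)-\epsilon .$$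
   Context: Model. Real parameters $\lambda,\beta>0$ and $0<\mu_1<\mu_2$ satisfy $\lambda+\mu_1+\mu_2+\beta=1$; service cost rates $0=c_{\mu_1}<c_{\mu_2}$; a fixed rate $\mu\in\{\mu_1,\mu_2\}$ with $\mu>\lambda$. The holding cost $h:\mathbb{N}_0\to\mathbb{R}$ satisfies $h(0)=0$, is non-negative, non-decreasing, convex, unbounded, and $\sum_{i\ge 0}h(i)x^i<\infty$ for all $0<x<1$. State space $S=\mathbb{N}_0\times\{0,1\}$. $\Phi$ is the set of stationary deterministic policies $\phi$, with $\phi(i,1)\in\{\mu_1,\mu_2\}$, $\phi(i,0)=\mu$. $\phi_0\in\Phi$ is the policy with $\phi_0(i,q)=\mu$ for all $(i,q)\in S$. Transition probabilities $p^\phi_{xy}$: from $(i,1)$ with $a=\phi(i,1)$, to $(i+1,1)$ w.p. $\lambda$, to $(i,0)$ w.p. $\beta$, to $(i-1,1)$ w.p. $a\mathbf 1_{\{i>0\}}$, to $(i,1)$ otherwise; from $(i,0)$, to $(i+1,0)$ w.p. $\lambda$, to $(i-1,0)$ w.p. $\mu\mathbf 1_{\{i>0\}}$, to $(i,0)$ otherwise. Costs $c^\phi(i,1)=c_{\phi(i,1)}+h(i)$, $c^\phi(i,0)=c_\mu+h(i)$. $\rho_\mu=\lambda/\mu$, $\pi_\mu(i)=(1-\rho_\mu)\rho_\mu^i$. Saved cost. For a distribution $p$ on $\mathbb{N}_0$ ($p=\delta_i$, the Dirac measure at $i$, or $p=\pi_\mu$) let $p^0,p^1$ be the distributions on $S$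 with $p^0(i,0)=p(i)=p^1(i,1)$ for $i\in\mathbb{N}_0$ and all other entries zero. For $\phi\in\Phi$, $$s^\phi(p)=\mathbb{E}^\phi_{p^0\times p^1}\Big[\sum_{n=0}^\infty\big(c^\phi(X_n)-c^\phi(Y_n)\big)\Big],$$ where $(X_n)$, $(Y_n)$ are the chains under $\phi$ with initial states $(X_0,Y_0)$ distributed as $p^0\times p^1$; $s(p)=\sup_{\phi\in\Phi}s^\phi(p)$. Weight function. Fix $\zeta$ with $1<\zeta<1/(1-\beta)$, and in addition: if $\mu_1>\lambda$, $\zeta<\min\{\mu_1/\lambda,\,1+\beta/\lambda\}$; if $\mu_1\le\lambda<\mu_2$ (so $\mu=\mu_2$), $\zeta<\min\Big\{1+\frac\beta\lambda,\ \frac\mu\lambda,\ \frac{(\lambda+\frac12\beta+\mu_1)+\sqrt{(\lambda+\frac12\beta+\mu_1)^2-4\lambda\mu_1}}{2\lambda}\Big\}$. Let $M(i,0)=\frac12\zeta^i$, $M(i,1)=\zeta^i$, $\|f\|_M=\sup_{x\in S}|f(x)|/M(x)$, and $$\eta=1-\lambda+\lambda\zeta+\max\Big\{-\beta,\,-\big(1-\tfrac1\zeta\big)\mu,\,-\big(1-\tfrac1\zeta\big)\mu_1-\tfrac12\beta\Big\}<1.$$ Let $g^\ast=g_\mu=c_\mu+(1-\rho_\mu)\sum_{i\ge0}h(i)\rho_\mu^i$. $H^\ast:S\to\mathbb{R}$ is the unique function with $\|H^\ast\|_M<\infty$, $H^\ast(0,0)=0$ and $g^\ast+H^\ast(x)=\min_{\phi\in\Phi}\{c^\phi(x)+\sum_yp^\phi_{xy}H^\ast(y)\}$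 for all $x\in S$. $u_M$ is a constant with $u_M\ge\max\{\sup_{\phi}\|c^\phi\|_M,\|g^\ast\mathbf 1\|_M\}$, $\mathbf 1$ the constant function one. $\beta$-discounted auxiliary model on $\mathbb{N}_0$: its Value Iteration is $V'_{\beta,0}\equiv0$ and $$V'_{\beta,n+1}(i)=\min_{a\in\{\mu_1,\mu_2\}}\big\{c_a+h(i)-g_\mu+\beta H^\ast(i,0)+a\mathbf 1_{\{i>0\}}V'_{\beta,n}(i-1)+(1-\beta-\lambda-a\mathbf 1_{\{i>0\}})V'_{\beta,n}(i)+\lambda V'_{\beta,n}(i+1)\big\}$$ (for $i=0$ the term with $V'_{\beta,n}(-1)$ is absent). The $n$-stage optimal policy $\tilde\phi_n$ picks in each $i$ a minimising action in the formula defining $V'_{\beta,n}(i)$ from $V'_{\beta,n-1}$. For $\epsilon'>0,k\in\mathbb{N}_0$, $$\tilde n_{\epsilon',k}=\Big\lceil\log_{(1-\beta)\zeta}\Big(\frac{\epsilon'(1-(1-\beta)\zeta)}{\tilde K\zeta^k}\Big)\Big\rceil,\quad \tilde K=g_\mu+u_M+\frac{\beta u_M}{1-\eta}.$$ For $\epsilon'>0$ and $k\in\mathbb{N}_0$, $\phi^k_{\epsilon'}\in\Phi$ is the policy with $\phi^k_{\epsilon'}(j,1)=\tilde\phi_{\tilde n_{\epsilon'/2,k}}(j)$ for all $j\in\mathbb{N}_0$; so $\phi^{\tilde k}_{\epsilon/2}$ is given by $\tilde\phi_{\tilde n_{\epsilon/4,\tilde k}}$. *)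

(* Defs.v *)
From HB Require Import structures.
From mathcomp Require Import all_boot all_order all_algebra.
From mathcomp Require Import all_classical all_reals all_analysis.

Set Implicit Arguments.
Unset Strict Implicit.
Unset Printing Implicit Defensive.

Import Order.TTheory GRing.Theory Num.Theory.
Import numFieldNormedType.Exports.

Local Open Scope classical_set_scope.
Local Open Scope ring_scope.

Record model (R : realType) := Model {
  lam : R;
  bet : R;
  mu1 : R;
  mu2 : R;
  mu : R;
  srv : R -> R; (* a |-> c_a; only the values at mu1 and mu2 matter *)
  hold : nat -> R;
  lam_gt0 : 0 < lam;
  bet_gt0 : 0 < bet;
  mu1_gt0 : 0 < mu1;
  mu1_lt_mu2 : mu1 < mu2;
  uniformized : lam + mu1 + mu2 + bet = 1;
  srv_mu1 : srv mu1 = 0;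
  srv_mu2 : 0 < srv mu2;
  mu_action : mu = mu1 \/ mu = mu2;
  mu_gt_lam : lam < mu;
  hold0 : hold 0 = 0;
  hold_ge0 : forall i, 0 <= hold i;
  hold_nondecreasing : forall i j, (i <= j)%N -> hold i <= hold j;
  hold_convex : forall i, hold i.+1 - hold i <= hold i.+2 - hold i.+1;
  hold_unbounded : forall b : R, exists i, b < hold i;
  hold_summable : forall x : R, 0 < x < 1 ->
    cvgn (series (fun i => hold i * x ^+ i))
}.

(* (i, true) stands for (i, 1) and (i, false) for (i, 0). *)
Definition state := (nat * bool)%type.

Section Model.
Variables (R : realType) (m : model R).

Definition policies : set (state -> R) :=
  [set phi | (forall i, phi (i, true) = mu1 m \/ phi (i, true) = mu2 m) /\
             (forall i, phi (i, false) = mu m)].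

Definition phi0 : state -> R := fun=> mu m.

(* The indicators (0 < i)%:R neutralise the state i.-1 when i = 0. *)
Definition trans (phi : state -> R) (x y : state) : R :=
  match x with
  | (i, true) =>
      let a := phi (i, true) * (0 < i)%N%:R in
      lam m * (y == (i.+1, true))%:R + bet m * (y == (i, false))%:R
      + a * (y == (i.-1, true))%:R
      + (1 - lam m - bet m - a) * (y == (i, true))%:R
  | (i, false) =>
      let a := mu m * (0 < i)%N%:R in
      lam m * (y == (i.+1, false))%:R
      + a * (y == (i.-1, false))%:R
      + (1 - lam m - a) * (y == (i, false))%:R
  end.

Definition cost (phi : state -> R) (x : state) : R :=
  srv m (phi x) + hold m x.1.

Definition rho : R := lam m / mu m.

Definition stat_dist (i : nat) : R := (1 - rho) * rho ^+ i.

Definition dirac_dist (i j : nat) : R := (j == i)%:R.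

(* p^q, the copy of p on the states (i, q). *)
Definition init_dist (q : bool) (p : nat -> R) (x : state) : R :=
  if x.2 == q then p x.1 else 0.

(* Distribution of the n-th state of the chain started from nu; every state
   has finitely many predecessors, so the sum has finite support. *)
Fixpoint law (phi : state -> R) (nu : state -> R) (n : nat) (y : state) : R :=
  if n is k.+1 then \sum_(x \in [set: state]) law phi nu k x * trans phi x y
  else nu y.

(* Expected cost at time n; costs are nonnegative, hence the unconditional
   extended-real sum. *)
Definition expected_cost (phi : state -> R) (nu : state -> R) (n : nat)
    : \bar R :=
  \esum_(x in [set: state]) (law phi nu n x * cost phi x)%:E.

(* E[sum_n (c(X_n) - c(Y_n))] is the limit of the expectations of the partial
   sums, which depend only on the marginal laws of X_n and Y_n (for independent
   chains the pathwise series does not converge). *)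
Definition saved_cost (phi : state -> R) (p : nat -> R) : \bar R :=
  (\sum_(0 <= n <oo) (expected_cost phi (init_dist false p) n
                      - expected_cost phi (init_dist true p) n))%E.

Definition opt_saved_cost (p : nat -> R) : \bar R :=
  ereal_sup [set saved_cost phi p | phi in policies].

Definition gmu : R :=
  srv m (mu m) + (1 - rho) * limn (series (fun i => hold m i * rho ^+ i)).

Section Weight.
Variable zeta : R.

Definition admissible_weight : Prop :=
  [/\ 1 < zeta < (1 - bet m)^-1,
      lam m < mu1 m ->
        zeta < Num.min (mu1 m / lam m) (1 + bet m / lam m) &
      mu1 m <= lam m < mu2 m ->
        let b := lam m + bet m / 2 + mu1 m in
        zeta < Num.min (1 + bet m / lam m)
                 (Num.min (mu m / lam m)
                    ((b + Num.sqrt (b ^+ 2 - 4 * lam m * mu1 m))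
                     / (2 * lam m)))].

Definition weight (x : state) : R :=
  if x.2 then zeta ^+ x.1 else zeta ^+ x.1 / 2.

Definition wnorm (f : state -> R) : \bar R :=
  ereal_sup [set (`|f x| / weight x)%:E | x in [set: state]].

Definition eta : R :=
  1 - lam m + lam m * zeta
  + Num.max (- bet m)
      (Num.max (- ((1 - zeta^-1) * mu m))
               (- ((1 - zeta^-1) * mu1 m) - bet m / 2)).

(* The characterisation of H^*; the right-hand side of the optimality equation
   is a minimum over policies: a lower bound that is attained. *)
Definition relative_value (H : state -> R) : Prop :=
  let rhs phi x :=
    cost phi x + \sum_(y \in [set: state]) trans phi x y * H y in
  [/\ (wnorm H < +oo)%E,
      H (0%N, false) = 0 &
      forall x,
        (forall phi, policies phi -> gmu + H x <= rhs phi x) /\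
        (exists2 phi, policies phi & gmu + H x = rhs phi x)].

Definition cost_bound (uM : R) : Prop :=
  (maxe (ereal_sup [set wnorm (cost phi) | phi in policies])
        (wnorm (fun=> gmu)) <= uM%:E)%E.

Definition log_base (b x : R) : R := ln x / ln b.

Variable uM : R.

Definition Ktilde : R := gmu + uM + bet m * uM / (1 - eta).

(* zeta ^ k is an integer power. *)
Definition ntilde (e : R) (k : int) : int :=
  Num.ceil (log_base ((1 - bet m) * zeta)
              (e * (1 - (1 - bet m) * zeta) / (Ktilde * zeta ^ k))).

Definition ktilde (eps : R) : int :=
  Num.ceil (log_base (rho * zeta)
              (eps * (1 - eta) * (1 - rho * zeta)
               / (4 * uM * (1 - rho)))).

(* phi^k_e, given the n-stage optimal policies tphi n of the discounted model;
   a negative number of stages is read as 0. *)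
Definition phik (tphi : nat -> nat -> R) (e : R) (k : int) : state -> R :=
  fun x => if x.2 then tphi (absz (Num.max 0 (ntilde (e / 2) k))) x.1 else mu m.

End Weight.

Section ValueIteration.
Variable H : state -> R.

Definition stage_value (V : nat -> R) (i : nat) (a : R) : R :=
  let a' := a * (0 < i)%N%:R in
  srv m a + hold m i - gmu + bet m * H (i, false) + a' * V i.-1
  + (1 - bet m - lam m - a') * V i + lam m * V i.+1.

Fixpoint Vdisc (n : nat) (i : nat) : R :=
  if n is k.+1 then
    Num.min (stage_value (Vdisc k) i (mu1 m)) (stage_value (Vdisc k) i (mu2 m))
  else 0.

(* tphi n is an n-stage optimal policy, with ties broken arbitrarily; for
   n = 0 there is nothing to minimise and any choice of actions is allowed. *)
Definition stage_optimal (tphi : nat -> nat -> R) : Prop :=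
  (forall n i, tphi n i = mu1 m \/ tphi n i = mu2 m) /\
  (forall n i, stage_value (Vdisc n) i (tphi n.+1 i) = Vdisc n.+1 i).

End ValueIteration.
End Model.

(* Main.v *)
(** Once the chain has left the states (i,1) it no longer depends on the policy,
    so the value of a policy phi is a pair (H( . ,0), V), where V solves a
    (1 - bet)-discounted evaluation equation in the norm weighted by zeta^i.
    Telescoping this Poisson equation, the cost saved up to time N is
    H(i,0) - V(i) plus an error governed by the difference of the N-step means
    started from (i,0) and (i,1); that difference decays geometrically because
    increments in the queue length follow a chain killed at (0,0), which
    contracts the weighted norm.  Hence the saved cost from i is H(i,0) - V(i),
    and maximising it amounts to minimising V, with minimum H( . ,1).  For
    i <= ktilde the greedy policy of value iteration is eps/2-optimal by the
    usual contraction bounds; for i > ktilde the bound uM/(1 - eta) on values is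
    integrated against the geometric tail of the stationary distribution. *)

Require Import Defs.
From HB Require Import structures.
From mathcomp Require Import all_boot all_order all_algebra.
From mathcomp Require Import all_classical all_reals all_analysis.
From mathcomp Require Import ring lra.
Import Order.TTheory GRing.Theory Num.Theory.
Import numFieldNormedType.Exports.
Local Open Scope ring_scope.

Set Implicit Arguments.
Unset Strict Implicit.
Unset Printing Implicit Defensive.

(** * Finitely supported sums *)

Lemma esum_EFin_fsbig (R : realType) (T : choiceType) (r : seq T) (f : T -> R) :
  (forall x, 0 <= f x) -> (forall x, x \notin r -> f x = 0) ->
  (\esum_(x in [set: T]) (f x)%:E)%E = (\sum_(x \in [set: T]) f x)%:E.
Proof.
move=> f0 fr.
have -> : (\esum_(x in [set: T]) (f x)%:E = \esum_(x in [set` r]) (f x)%:E)%E.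
  rewrite [RHS]esum_mkcond; apply: eq_esum => x _.
  by case: ifPn => //; rewrite notin_setE /= => /negP/fr ->.
rewrite esum_fset => [|//|x _]; last by rewrite lee_fin.
rewrite fsumEFin //; congr EFin; apply: fsbig_widen => //.
by move=> x [_ /= /negP]; exact: fr.
Qed.

Lemma sum_point_mass (R : pzSemiRingType) (T : eqType) (r : seq T) (z : T) (c : R)
    (f : T -> R) : uniq r -> z \in r ->
  \sum_(y <- r) c * (y == z)%:R * f y = c * f z.
Proof.
move=> ur zr; rewrite (big_rem z) //= eqxx mulr1 big_seq big1 ?addr0 // => y.
by rewrite mem_rem_uniq // inE => /andP[/negPf -> _]; rewrite mulr0 mul0r.
Qed.

(** * The chain and its expected costs *)

Section Chain.
Variables (R : realType) (m : model R).
Local Notation policies := (policies m).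

(** The one-step expectation operator of the chain in closed form, so that later arguments are
    arithmetic on at most four values of [f]. *)
Definition pstep (phi f : state -> R) (x : state) : R :=
  match x with
  | (i, true) =>
      let a := phi (i, true) * (0 < i)%N%:R in
      lam m * f (i.+1, true) + bet m * f (i, false) + a * f (i.-1, true)
      + (1 - lam m - bet m - a) * f (i, true)
  | (i, false) =>
      let a := mu m * (0 < i)%N%:R in
      lam m * f (i.+1, false) + a * f (i.-1, false) + (1 - lam m - a) * f (i, false)
  end.

(** A superset of the successors of [x], enlarged until the relation is symmetric: the same list
    then supports sums over successors and over predecessors. *)
Definition neighbours (x : state) : seq state :=
  [:: (x.1.+1, x.2); (x.1.-1, x.2); (x.1, true); (x.1, false)].

Lemma neighbours_sym x y : y \in neighbours x -> x \in neighbours y.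
Proof.
case: x => j q'; case: y => i q; rewrite /neighbours !inE !xpair_eqE /=.
by case/or4P => /andP[/eqP-> /eqP->]; case: q'; case: j => [|j] /=;
  rewrite ?eqxx ?orbT.
Qed.

Lemma trans_support phi x y : y \notin neighbours x -> trans m phi x y = 0.
Proof.
case: x => i []; rewrite /neighbours !inE !negb_or;
  by move=> /and4P[/negPf H1 /negPf H2 /negPf H3 /negPf H4] /=;
     rewrite ?H1 ?H2 ?H3 ?H4 !mulr0 !addr0.
Qed.

Lemma sum_trans phi f x :
  \sum_(y \in [set: state]) trans m phi x y * f y = pstep phi f x.
Proof.
(* At [i = 0] the predecessor [i.-1] is [i] itself, so the list has repetitions. *)
have ur : uniq (undup (neighbours x)) by exact: undup_uniq.
rewrite (fsbigE (undup (neighbours x))) //; last first.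
  by move=> y _; rewrite mem_undup => /(trans_support phi) ->; rewrite mul0r.
under eq_bigl do rewrite in_setT.
have nbr z : z \in neighbours x -> z \in undup (neighbours x) by rewrite mem_undup.
case: x ur nbr => i []; rewrite /trans; move: (undup _) => r ur nbr.
- rewrite (eq_bigr _ (fun y _ => mulrDl _ _ _)) big_split /=.
  rewrite (eq_bigr _ (fun y _ => mulrDl _ _ _)) big_split /=.
  rewrite (eq_bigr _ (fun y _ => mulrDl _ _ _)) big_split /=.
  by rewrite !sum_point_mass //; apply: nbr; rewrite !inE eqxx ?orbT.
- rewrite (eq_bigr _ (fun y _ => mulrDl _ _ _)) big_split /=.
  rewrite (eq_bigr _ (fun y _ => mulrDl _ _ _)) big_split /=.
  by rewrite !sum_point_mass //; apply: nbr; rewrite !inE eqxx ?orbT.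
Qed.

Lemma rates : [/\ 0 < lam m, 0 < bet m, 0 < mu1 m, mu1 m < mu2 m &
  lam m + mu1 m + mu2 m + bet m = 1].
Proof.
by split; [exact: lam_gt0|exact: bet_gt0|exact: mu1_gt0|exact: mu1_lt_mu2|
  exact: uniformized].
Qed.

Lemma mu_bounds : mu1 m <= mu m <= mu2 m.
Proof. by have [? ? ? ? ?] := rates; case: (mu_action m) => ->; lra. Qed.

Lemma policy_bounds phi i : policies phi -> mu1 m <= phi (i, true) <= mu2 m.
Proof.
by have [? ? ? ? ?] := rates; move=> [/(_ i) [] -> _]; lra.
Qed.

Lemma trans_ge0 phi x y : policies phi -> 0 <= trans m phi x y.
Proof.
move=> pphi; have [? ? ? ? ?] := rates; have := mu_bounds.
have d0 (b : bool) : 0 <= b%:R :> R by exact: ler0n.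
case: x => i [] /=; last first.
  by move=> ?; rewrite !addr_ge0 // mulr_ge0 ?mulr_ge0 //; 
    case: (0 < i)%N => /=; rewrite ?mulr1 ?mulr0; lra.
have := policy_bounds i pphi.
by move=> ? _; rewrite !addr_ge0 // mulr_ge0 ?mulr_ge0 //; 
    case: (0 < i)%N => /=; rewrite ?mulr1 ?mulr0; lra.
Qed.

Lemma pstep_ge0 phi f x : policies phi -> (forall y, 0 <= f y) ->
  0 <= pstep phi f x.
Proof.
move=> pphi f0; rewrite -sum_trans.
by apply: fsumr_ge0 => y _; rewrite mulr_ge0 ?trans_ge0.
Qed.

Lemma law_ge0 phi nu n x : policies phi -> (forall y, 0 <= nu y) ->
  0 <= law m phi nu n x.
Proof.
move=> pphi nu0; elim: n x => [//|n IH] x /=.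
by apply: fsumr_ge0 => y _; rewrite mulr_ge0 ?trans_ge0.
Qed.

(* The expectation of f at time n, computed backwards from the initial state. *)
Lemma esum_law phi nu f n : policies phi -> (forall y, 0 <= nu y) ->
    (forall y, 0 <= f y) ->
  (\esum_(x in [set: state]) (law m phi nu n x * f x)%:E)%E =
  (\esum_(x in [set: state]) (nu x * iter n (pstep phi) f x)%:E)%E.
Proof.
move=> pphi nu0; elim: n f => [//|n IH] f f0; rewrite iterSr -IH; last first.
  by move=> y; exact: pstep_ge0.
have t0 x y : 0 <= law m phi nu n x * trans m phi x y.
  by rewrite mulr_ge0 ?law_ge0 ?trans_ge0.
(* Moves the last transition from the law onto [f]: all terms are nonnegative, so Tonelli swaps the
   two sums, and the sum over the successor [y] becomes [pstep phi f x]. *)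
transitivity (\esum_(y in [set: state]) \esum_(x in [set: state])
    (law m phi nu n x * trans m phi x y * f y)%:E)%E.
  apply: eq_esum => y _ /=.
  have supp x : x \notin neighbours y -> law m phi nu n x * trans m phi x y = 0.
    move=> xy; rewrite trans_support ?mulr0 //; apply: contra xy.
    exact: neighbours_sym.
  rewrite (esum_EFin_fsbig (r := neighbours y));
    last 2 first.
    + by move=> x; rewrite mulr_ge0.
    + by move=> x /supp ->; rewrite mul0r.
  congr EFin; rewrite !(fsbigE (undup (neighbours y)))
    ?undup_uniq //.
  + by rewrite mulr_suml.
  + by move=> x _; rewrite mem_undup => /supp ->; rewrite mul0r.
  + by move=> x _; rewrite mem_undup => /supp ->.
pose w (p : state * state) := (law m phi nu n p.1 * trans m phi p.1 p.2 * f p.2)%:E.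
have w0 p : (0 <= w p)%E by rewrite lee_fin mulr_ge0.
rewrite (@esum_esum _ _ _ setT (fun=> setT) (fun y x => w (x, y))) //.
rewrite -(@reindex_esum _ _ _ (setT `*`` fun=> setT) (setT `*`` fun=> setT)
  (fun p => (p.2, p.1)) w); last first.
  split => [[x y] _ //=|[x y] [x' y'] _ _ [-> ->]//|[x y] _].
  by exists (y, x).
rewrite (eq_esum (b := fun p => w (p.1, p.2))); last by case.
rewrite -(@esum_esum _ _ _ setT (fun=> setT) (fun x y => w (x, y))) //.
apply: eq_esum => x _.
have ta y : 0 <= law m phi nu n x * trans m phi x y * f y by rewrite mulr_ge0.
have tb y : y \notin neighbours x -> trans m phi x y * f y = 0.
  by move=> /(trans_support phi) ->; rewrite mul0r.
rewrite (esum_EFin_fsbig (r := neighbours x)) //; last first.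
  by move=> y /tb H0; rewrite -mulrA H0 mulr0.
congr EFin; rewrite -sum_trans.
rewrite !(fsbigE (undup (neighbours x))) ?undup_uniq //.
- by rewrite mulr_sumr; apply: eq_bigr => y _; rewrite mulrA.
- by move=> y _; rewrite mem_undup => /tb.
- by move=> y _; rewrite mem_undup => /tb H0; rewrite -mulrA H0 mulr0.
Qed.

End Chain.

(** * Contraction estimates *)

Lemma normrM_le (R : numDomainType) (p u v : R) :
  0 <= p -> `|u| <= v -> `|p * u| <= p * v.
Proof. by move=> p0 uv; rewrite normrM ger0_norm // ler_wpM2l. Qed.

Section Contraction.
Variables (R : realType) (m : model R) (zeta : R).
Hypothesis hzeta : admissible_weight m zeta.
Local Notation policies := (policies m).
Local Notation eta := (Defs.eta m zeta).
Local Notation weight := (weight zeta).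
Local Notation gam := ((1 - bet m) * zeta).

Lemma zeta_gt1 : 1 < zeta.
Proof. by case: hzeta => /andP[]. Qed.

Lemma zeta_gt0 : 0 < zeta.
Proof. by apply: lt_trans zeta_gt1. Qed.

Lemma gam_lt1 : gam < 1.
Proof.
have [? ? ? ? ?] := rates m; case: hzeta => /andP[_ h _ _].
have b0 : 0 < 1 - bet m by lra.
by rewrite -(ltr_pM2l b0) mulfV ?gt_eqF in h.
Qed.

Lemma gam_gt0 : 0 < gam.
Proof. by have [? ? ? ? ?] := rates m; rewrite mulr_gt0 ?zeta_gt0 //; lra. Qed.

Lemma mu_gt0 : 0 < mu m.
Proof. by rewrite (lt_trans (lam_gt0 m)) ?mu_gt_lam. Qed.

Lemma rho_gt0 : 0 < rho m.
Proof. by rewrite divr_gt0 ?mu_gt0 ?lam_gt0. Qed.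

Lemma rho_lt1 : rho m < 1.
Proof. by rewrite ltr_pdivrMr ?mu_gt0 ?mul1r ?mu_gt_lam. Qed.

(** The first bound makes the stationary distribution integrate [zeta ^+ i]; both feed into
    [eta < 1]. If [mu1 <= lam], then [lam < mu] forces [lam < mu2], so the second set of
    restrictions on [zeta] applies. *)
Lemma zeta_bounds : zeta * lam m < mu m /\ lam m * (zeta - 1) < bet m.
Proof.
have [l0 ? ? ? ?] := rates m; have /andP[? ?] := mu_bounds m.
have b1 : zeta < 1 + bet m / lam m -> lam m * (zeta - 1) < bet m.
  by rewrite -ltrBlDl ltr_pdivlMr // mulrC.
case: hzeta => _ small large; case: (ltP (lam m) (mu1 m)) => lm1.
  have := small lm1; rewrite lt_min ltr_pdivlMr // => /andP[? /b1]; lra.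
have lm2 : lam m < mu2 m by rewrite (lt_le_trans (mu_gt_lam m)).
have := large; rewrite lm1 lm2 => /(_ isT) /=; rewrite !lt_min => /and3P[/b1 ? + _].
by rewrite ltr_pdivlMr.
Qed.

Lemma rhozeta_lt1 : rho m * zeta < 1.
Proof.
by rewrite /rho mulrAC ltr_pdivrMr ?mu_gt0 // mul1r mulrC; case: zeta_bounds.
Qed.

Lemma rhozeta_gt0 : 0 < rho m * zeta.
Proof. by rewrite mulr_gt0 ?rho_gt0 ?zeta_gt0. Qed.

(* The last bound on zeta is the larger root of
   lam z^2 - (lam + bet/2 + mu1) z + mu1, which is negative at 1. *)
Lemma zeta_root : lam m * (zeta - 1) < (1 - zeta^-1) * mu1 m + bet m / 2.
Proof.
have [l0 ? ? ? ?] := rates m; have z1 := zeta_gt1; have z0 := zeta_gt0.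
suff main : lam m * zeta ^+ 2 - (lam m + bet m / 2 + mu1 m) * zeta + mu1 m < 0.
  rewrite -(ltr_pM2r z0) mulrDl (mulrAC (1 - _)) mulrBl mul1r mulVf ?gt_eqF //.
  by move: main; rewrite expr2; lra.
(* For [lam < mu1] the quadratic is [(zeta - 1) * (lam * zeta - mu1) - bet / 2 * zeta], whose
   product is negative for [1 < zeta < mu1 / lam]. *)
case: hzeta => _ small large; case: (ltP (lam m) (mu1 m)) => lm1.
  have := small lm1; rewrite lt_min ltr_pdivlMr // => /andP[? _]; nra.
have lm2 : lam m < mu2 m.
  by rewrite (lt_le_trans (mu_gt_lam m)) //; case/andP: (mu_bounds m).
have := large; rewrite lm1 lm2 => /(_ isT) /=; rewrite !lt_min => /and3P[_ _].
set b := lam m + _ + _; set s := Num.sqrt _; rewrite ltr_pdivlMr ?mulr_gt0 //.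
have s0 : 0 <= s by exact: sqrtr_ge0.
have bE : b = lam m + bet m / 2 + mu1 m by [].
have s2 : s ^+ 2 = b ^+ 2 - 4 * lam m * mu1 m by rewrite sqr_sqrtr // bE; nra.
(* The quadratic equals [- bet / 2] at 1, so 1 exceeds its smaller root, and hence so does
   [zeta]. *)
have lo : b - s < zeta * (2 * lam m).
  suff : b - 2 * lam m < s by nra.
  have [?|?] := ltP (b - 2 * lam m) 0; first by lra.
  rewrite -(@ltr_pXn2r _ 2) ?nnegrE // s2 bE; nra.
move=> up; have : (zeta * (2 * lam m) - b) ^+ 2 < s ^+ 2.
  by rewrite -subr_gt0 subr_sqr mulr_gt0 //; lra.
have l4 : 0 < 4 * lam m by lra.
by rewrite s2 -(pmulr_rlt0 _ l4) bE => h; lra.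
Qed.

Lemma eta_lt1 : eta < 1.
Proof.
have [l0 ? ? ? ?] := rates m; have z1 := zeta_gt1; have z0 := zeta_gt0.
have [h1 h2] := zeta_bounds; have h3 := zeta_root.
have h4 : lam m * (zeta - 1) < (1 - zeta^-1) * mu m.
  rewrite -(ltr_pM2r z0) (mulrAC (1 - _)) mulrBl mul1r mulVf ?gt_eqF //.
  by nra.
rewrite /Defs.eta -ltrBrDl !gt_max; apply/and3P; split; lra.
Qed.

(** In this order, the contraction rates of the killed chain in (0,1), in (i,0) and in (i,1) with i
    > 0; the state (0,0) is covered by the first. *)
Lemma eta_ge : [/\ 1 - lam m + lam m * zeta - bet m <= eta,
  1 - lam m + lam m * zeta - (1 - zeta^-1) * mu m <= eta &
  1 - lam m + lam m * zeta - (1 - zeta^-1) * mu1 m - bet m / 2 <= eta].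
Proof. by split; rewrite /Defs.eta -?addrA !lerD2l !le_max lexx ?orbT. Qed.

Lemma eta_gt0 : 0 < eta.
Proof.
have [l0 ? ? ? ?] := rates m; have z1 := zeta_gt1; have [h _ _] := eta_ge.
by apply: lt_le_trans h; nra.
Qed.

Lemma weight_gt0 x : 0 < weight x.
Proof.
have z0 := zeta_gt0.
by rewrite /weight; case: ifP => _; rewrite ?divr_gt0 ?exprn_gt0.
Qed.

Lemma expz_gt0 i : 0 < zeta ^+ i.
Proof. by rewrite exprn_gt0 ?zeta_gt0. Qed.

(* A function vanishing at (0,0) does not see the transitions into (0,0), and
   the chain killed there contracts the weighted norm. *)
Lemma pstep_killed phi f C x : policies phi -> 0 <= C -> f (0%N, false) = 0 ->
  (forall y, `|f y| <= C * weight y) -> `|pstep m phi f x| <= eta * C * weight x.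
Proof.
move=> pphi C0 f0 fC; have [l0 ? ? ? ?] := rates m; have z1 := zeta_gt1.
have z0 := zeta_gt0; have [h1 h2 h3] := eta_ge; have /andP[? ?] := mu_bounds m.
have fF i : `|f (i, false)| <= C * zeta ^+ i / 2.
  by rewrite (le_trans (fC _)) // /Defs.weight /= mulrA.
have fT i : `|f (i, true)| <= C * zeta ^+ i by rewrite (le_trans (fC _)).
have zV : zeta^-1 * zeta = 1 by rewrite mulVf ?gt_eqF.
case: x => -[|j] [] /=; rewrite /Defs.weight /= ?expr0 ?mulr0 ?mul0r ?addr0 ?subr0 ?mulr1.
- rewrite f0 mulr0 addr0 (le_trans (ler_normD _ _)) //.
  apply: le_trans (lerD (normrM_le _ (fT _)) (normrM_le _ (fT _))) _; [lra..|].
  rewrite expr1 expr0; suff : lam m * zeta + (1 - lam m - bet m) <= eta by nra.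
  by lra.
- rewrite f0 mulr0 addr0.
  apply: le_trans (normrM_le _ (fF _)) _; first by lra.
  rewrite expr1; suff : lam m * zeta <= eta by nra.
  by lra.
- have /andP[p1 p2] := policy_bounds j.+1 pphi; set a := phi _ in p1 p2 *.
  set W := C * zeta ^+ j; have W0 : 0 <= W by rewrite mulr_ge0 // ltW ?expz_gt0.
  have {}fT0 : `|f (j, true)| <= W by exact: fT.
  have {}fT1 : `|f (j.+1, true)| <= zeta * W by rewrite (le_trans (fT _)) // exprS mulrCA.
  have {}fT2 : `|f (j.+2, true)| <= zeta * (zeta * W).
    by rewrite (le_trans (fT _)) // !exprS /W; nra.
  (* The half weight of (i,0) is what turns the transition of rate [bet] into a gain of
     [bet / 2]. *)
  have {}fF1 : `|f (j.+1, false)| <= zeta * W / 2.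
    by rewrite (le_trans (fF _)) // exprS /W; nra.
  rewrite (le_trans (ler_normD _ _)) //.
  apply: le_trans (lerD (ler_normD _ _) (normrM_le _ fT1)) _; first by lra.
  apply: le_trans (lerD (lerD (ler_normD _ _) (normrM_le _ fT0)) (lexx _)) _; first by lra.
  apply: le_trans (lerD (lerD (lerD (normrM_le _ fT2) (normrM_le _ fF1)) (lexx _)) (lexx _)) _; [lra..|].
  have -> : eta * C * zeta ^+ j.+1 = eta * zeta * W by rewrite exprS /W; ring.
  have : (1 - lam m + lam m * zeta - (1 - zeta^-1) * mu1 m - bet m / 2) * zeta <= eta * zeta.
    by rewrite ler_pM2r.
  have -> : (1 - lam m + lam m * zeta - (1 - zeta^-1) * mu1 m - bet m / 2) * zeta =
    (1 - lam m + lam m * zeta - bet m / 2) * zeta - (zeta - zeta^-1 * zeta) * mu1 m by ring.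
  (* The bound is decreasing in [a] because [1 - zeta < 0], so [a = mu1] is the worst case. *)
  rewrite zV => h; apply: (@le_trans _ _ ((lam m * zeta ^+ 2 + bet m * zeta / 2 + a
    + (1 - lam m - bet m - a) * zeta) * W)); first by lra.
  by apply: ler_wpM2r => //; nra.
- set W := C * zeta ^+ j; have W0 : 0 <= W by rewrite mulr_ge0 // ltW ?expz_gt0.
  have {}fT0 : `|f (j, false)| <= W / 2 by exact: fF.
  have {}fT1 : `|f (j.+1, false)| <= zeta * W / 2.
    by rewrite (le_trans (fF _)) // exprS /W; nra.
  have {}fT2 : `|f (j.+2, false)| <= zeta * (zeta * W) / 2.
    by rewrite (le_trans (fF _)) // !exprS /W; nra.
  rewrite (le_trans (ler_normD _ _)) //.
  apply: le_trans (lerD (ler_normD _ _) (normrM_le _ fT1)) _; first by lra.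
  apply: le_trans (lerD (lerD (normrM_le _ fT2) (normrM_le _ fT0)) (lexx _)) _; [lra..|].
  have -> : eta * C * (zeta ^+ j.+1 / 2) = eta * zeta * W / 2 by rewrite exprS /W; ring.
  have : (1 - lam m + lam m * zeta - (1 - zeta^-1) * mu m) * zeta <= eta * zeta.
    by rewrite ler_pM2r.
  have -> : (1 - lam m + lam m * zeta - (1 - zeta^-1) * mu m) * zeta =
    (1 - lam m + lam m * zeta) * zeta - (zeta - zeta^-1 * zeta) * mu m by ring.
  rewrite zV => h; apply: (@le_trans _ _ ((lam m * zeta ^+ 2 + mu m
    + (1 - lam m - mu m) * zeta) * (W / 2))); first by lra.
  rewrite -(mulrA _ W); apply: ler_wpM2r => //; [lra|nra].
Qed.

(** Crude, since it only uses that the queue grows by at most one per step, but free of any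
    condition at (0,0). It makes the mean cost at each fixed time integrable against the stationary
    distribution. *)
Lemma pstep_growth phi f C x : policies phi ->
  (forall y, `|f y| <= C * zeta ^+ y.1) -> `|pstep m phi f x| <= C * zeta * zeta ^+ x.1.
Proof.
move=> pphi fC; have [l0 ? ? ? ?] := rates m; have z1 := zeta_gt1.
have z0 := zeta_gt0; have /andP[? ?] := mu_bounds m.
have C0 : 0 <= C by have := fC (0%N, true); rewrite expr0 mulr1; apply: le_trans.
have near i q : (i <= x.1.+1)%N -> `|f (i, q)| <= C * zeta * zeta ^+ x.1.
  move=> ix; rewrite (le_trans (fC _)) // -mulrA -exprS ler_wpM2l //.
  by rewrite ler_eXn2l.
case: x near => i [] /=; set W := C * _ * _ => near.
- have /andP[a1 a2] := policy_bounds i pphi; set a := phi _ in a1 a2 *.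
  have := near i.+1 true (leqnn _); have := near i true (leqnSn _).
  have := near i.-1 true (leq_trans (leq_pred _) (leqnSn _)).
  have := near i false (leqnSn _).
  rewrite !ler_norml => /andP[? ?] /andP[? ?] /andP[? ?] /andP[? ?].
  by case: (0 < i)%N; rewrite /= ?mulr1 ?mulr0 ?mul0r; apply/andP; split; nra.
- have := near i.+1 false (leqnn _); have := near i false (leqnSn _).
  have := near i.-1 false (leq_trans (leq_pred _) (leqnSn _)).
  rewrite !ler_norml => /andP[? ?] /andP[? ?] /andP[? ?].
  by case: (0 < i)%N; rewrite /= ?mulr1 ?mulr0 ?mul0r; apply/andP; split; nra.
Qed.

(** The transitions that remain in the states (i,1): a substochastic kernel of mass [1 - bet], hence
    a contraction of rate [gam] in the norm weighted by [zeta ^+ i]. *)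
Definition qstep (a : R) (V : nat -> R) (i : nat) : R :=
  let a' := a * (0 < i)%N%:R in
  a' * V i.-1 + (1 - bet m - lam m - a') * V i + lam m * V i.+1.

Lemma qstep_le a V C i : mu1 m <= a <= mu2 m ->
  (forall j, V j <= C * zeta ^+ j) -> 0 <= C -> qstep a V i <= gam * C * zeta ^+ i.
Proof.
move=> /andP[? ?] VC C0; have [l0 ? ? ? ?] := rates m; have z1 := zeta_gt1.
have z0 := zeta_gt0.
have near j : (j <= i.+1)%N -> V j <= C * zeta ^+ i.+1.
  by move=> ji; rewrite (le_trans (VC _)) // ler_wpM2l // ler_weXn2l // ltW.
have /near b1 : (i.-1 <= i.+1)%N by rewrite (leq_trans (leq_pred i)).
have /near b2 : (i <= i.+1)%N by [].
have /near b3 : (i.+1 <= i.+1)%N by [].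
have -> : gam * C * zeta ^+ i = (1 - bet m) * (C * zeta ^+ i.+1) by rewrite exprS; ring.
move: b1 b2 b3; rewrite /qstep; set W := C * _.
by case: (0 < i)%N => /=; rewrite ?mulr1 ?mulr0 ?mul0r ?add0r; nra.
Qed.

Lemma qstepN a V i : qstep a (fun j => - V j) i = - qstep a V i.
Proof. by rewrite /qstep; ring. Qed.

Lemma qstepB a V W i : qstep a (fun j => V j - W j) i = qstep a V i - qstep a W i.
Proof. by rewrite /qstep; ring. Qed.

Lemma qstep_norm a V C i : mu1 m <= a <= mu2 m ->
  (forall j, `|V j| <= C * zeta ^+ j) -> `|qstep a V i| <= gam * C * zeta ^+ i.
Proof.
move=> ab VC.
have C0 : 0 <= C by have := VC 0%N; rewrite expr0 mulr1; apply: le_trans.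
rewrite ler_norml lerNl -qstepN !qstep_le // => j; have := VC j; rewrite ler_norml.
  by case/andP.
by rewrite lerNl => /andP[].
Qed.

Lemma le_of_geometric (x y c q : R) : 0 < q < 1 ->
  (forall n, x <= y + c * q ^+ n) -> x <= y.
Proof.
move=> /andP[q0 q1] h.
have cv : ((fun n => y + c * q ^+ n) @ \oo --> y)%classic.
  rewrite -[X in (_ --> X)%classic]addr0; apply: cvgD; first exact: cvg_cst.
  by apply: cvg_geometric; rewrite ger0_norm // ltW.
rewrite -(cvg_lim _ cv) //; apply: limr_ge; first by apply/cvg_ex; exists y.
exact: nearW.
Qed.

(** Iterating the inequality yields the geometric series of [b]; the a priori growth bound on [u] is
    multiplied by [gam ^+ n] and disappears in the limit. *)
Lemma qstep_subfix (act : nat -> R) u b C i : (forall j, mu1 m <= act j <= mu2 m) ->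
  0 <= b -> (forall j, u j <= C * zeta ^+ j) ->
  (forall j, u j <= b * zeta ^+ j + qstep (act j) u j) ->
  u i <= b / (1 - gam) * zeta ^+ i.
Proof.
move=> actb b0 uC ub; have g0 := gam_gt0; have g1 := gam_lt1; have zi := expz_gt0.
(* [C] may be negative, whereas [qstep_le] asks for a nonnegative constant. *)
pose C' := Num.max C 0.
have C'0 : 0 <= C' by rewrite le_max lexx orbT.
have bg0 : 0 <= b / (1 - gam) by rewrite divr_ge0 // subr_ge0 ltW.
have it n j : u j <= (b / (1 - gam) + C' * gam ^+ n) * zeta ^+ j.
  elim: n j => [|n IH] j.
    rewrite expr0 mulr1 (le_trans (uC _)) // ler_wpM2r ?(ltW (zi _)) //.
    by rewrite (@le_trans _ _ C') ?lerDr // le_max lexx.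
  apply: le_trans (ub j) _.
  have Cn0 : 0 <= b / (1 - gam) + C' * gam ^+ n.
    by rewrite addr_ge0 // mulr_ge0 // exprn_ge0 // ltW.
  apply: le_trans (lerD (lexx _) (qstep_le j (actb j) IH Cn0)) _.
  rewrite -mulrDl ler_wpM2r ?(ltW (zi _)) // exprS le_eqVlt; apply/orP; left.
  by apply/eqP; field; rewrite subr_eq0 gt_eqF.
apply: (@le_of_geometric _ _ (C' * zeta ^+ i) gam); first by rewrite g0.
by move=> n; rewrite (le_trans (it n i)) // mulrDl (mulrAC C').
Qed.

End Contraction.

(** * Cumulated costs and the Poisson equation *)

Section Pstep.
Variables (R : realType) (m : model R) (phi : state -> R).
Local Notation pstep := (pstep m phi).

Lemma pstepD f g x : pstep (fun y => f y + g y) x = pstep f x + pstep g x.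
Proof. by case: x => i [] /=; ring. Qed.

Lemma pstepB f g x : pstep (fun y => f y - g y) x = pstep f x - pstep g x.
Proof. by case: x => i [] /=; ring. Qed.

Lemma pstep_cst c x : pstep (fun=> c) x = c.
Proof. by case: x => i [] /=; ring. Qed.

Lemma eq_pstep f g : f =1 g -> pstep f =1 pstep g.
Proof. by move=> fg [i []] /=; rewrite !fg. Qed.

Lemma cumulated_pstep c N x :
  \sum_(0 <= n < N.+1) iter n pstep c x =
  c x + pstep (fun y => \sum_(0 <= n < N) iter n pstep c y) x.
Proof.
elim: N x => [|N IH] x.
  rewrite big_nat1 (eq_pstep (g := fun=> 0)) ?pstep_cst ?addr0 // => y.
  by rewrite big_nil.
rewrite big_nat_recr //= IH -addrA -pstepD; congr (_ + _).
by apply: eq_pstep => y; rewrite big_nat_recr.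
Qed.

Lemma cumulated_poisson c g G N x : (forall x, g + G x = c x + pstep G x) ->
  \sum_(0 <= n < N) iter n pstep c x = G x - iter N pstep G x + N%:R * g.
Proof.
move=> GE; elim: N x => [|N IH] x; first by rewrite big_nil subrr mul0r addr0.
rewrite cumulated_pstep (eq_pstep IH) pstepD pstepB pstep_cst.
by have := GE x; rewrite -natr1 mulrDl mul1r /=; lra.
Qed.

End Pstep.

(** * Merging of the means started from (i,0) and (i,1) *)

Section Decoupling.
Variables (R : realType) (m : model R) (zeta : R).
Hypothesis hzeta : admissible_weight m zeta.
Variable (phi : state -> R).
Hypothesis pphi : policies m phi.
Local Notation eta := (Defs.eta m zeta).
Local Notation weight := (weight zeta).
Local Notation gam := ((1 - bet m) * zeta).
Local Notation pstep := (pstep m phi).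

(** Set to 0 at (0,0), which encodes the killing, and on all (i,1), which are never reached from the
    states (i,0). *)
Definition queue_increment (f : state -> R) (x : state) : R :=
  if x is (i.+1, false) then f x - f (i, false) else 0.

(* Two coupled M/M/1 queues starting one customer apart merge when the shorter
   one is empty at a service completion, so increments evolve as in the chain
   killed at (0,0). *)
Lemma queue_increment_pstep f i : queue_increment (pstep f) (i.+1, false) =
  pstep (queue_increment f) (i.+1, false).
Proof. by case: i => [|i] /=; ring. Qed.

(** [G] itself need not vanish at (0,0), since its increments do by construction. The factor 2
    bounds an increment by two values of [G], the second of smaller weight. *)
Lemma queue_increment_iter G C N x : (forall y, `|G y| <= C * weight y) ->
  `|queue_increment (iter N pstep G) x| <= eta ^+ N * (C * 2) * weight x.
Proof.
move=> GC; have z0 := zeta_gt0 hzeta; have z1 := zeta_gt1 hzeta.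
have e0 := eta_gt0 hzeta.
have C0 : 0 <= C.
  have := GC (0%N, true); rewrite /Defs.weight /= expr0 mulr1; exact: le_trans.
elim: N x => [|N IH] x.
  rewrite expr0 mul1r /=; case: x => -[|i] [] /=;
    rewrite ?normr0 ?mulr_ge0 // ?(ltW (weight_gt0 hzeta _)) //.
  apply: le_trans (ler_normB _ _) _.
  apply: le_trans (lerD (GC _) (GC _)) _.
  rewrite -mulrDr -mulrA ler_wpM2l // mulr_natl mulr2n lerD2l.
  by rewrite /Defs.weight /= ler_pM2r ?invr_gt0 // ler_eXn2l.
have nul y : 0 <= eta ^+ N.+1 * (C * 2) * weight y.
  by rewrite mulr_ge0 ?(ltW (weight_gt0 hzeta _)) // mulr_ge0 ?mulr_ge0 // exprn_ge0 // ltW.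
case: x => -[|i] []; rewrite [queue_increment _ _]/= ?normr0 ?nul //.
rewrite -[X in `|X|]/(queue_increment (pstep (iter N pstep G)) (i.+1, false)).
rewrite queue_increment_pstep exprS -(mulrA eta); apply: pstep_killed => //.
by rewrite mulr_ge0 ?mulr_ge0 // exprn_ge0 // ltW.
Qed.

(** One step maps the difference between (i,0) and (i,1) to its image under [qstep], which contracts
    at rate [gam], plus a source proportional to a queue increment, which decays at rate [eta]. *)
Lemma decoupling G C : (forall y, `|G y| <= C * weight y) ->
  exists Y th, 0 < th < 1 /\ forall N i,
    `|iter N pstep G (i, false) - iter N pstep G (i, true)| <= Y * th ^+ N * zeta ^+ i.
Proof.
move=> GC; have z0 := zeta_gt0 hzeta; have zi := expz_gt0 hzeta.
have [l0 ? ? ? ?] := rates m; have /andP[? ?] := mu_bounds m.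
have e0 := eta_gt0 hzeta; have e1 := eta_lt1 hzeta.
have g0 := gam_gt0 hzeta; have g1 := gam_lt1 hzeta.
have C0 : 0 <= C.
  have := GC (0%N, true); rewrite /Defs.weight /= expr0 mulr1; exact: le_trans.
(* [th] lies strictly above [gam], so that the source can be absorbed even when [eta] and [gam]
   coincide. *)
pose mx := Num.max eta gam; pose th := (1 + mx) / 2.
have mx1 : mx < 1 by rewrite gt_max e1.
have emx : eta <= mx by rewrite le_max lexx.
have gmx : gam <= mx by rewrite le_max lexx orbT.
have th1 : 0 < th < 1 by rewrite /th; lra.
have the : eta <= th by rewrite /th; lra.
have thg : gam < th by rewrite /th; lra.
(* The first term gives [C + gam * Y <= th * Y] for the induction step, the second covers
   [N = 0]. *)
pose Y := C / (th - gam) + 2 * C.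
have YC : C + gam * Y <= th * Y.
  have : C / (th - gam) * (th - gam) = C by rewrite mulfVK // gt_eqF // subr_gt0.
  by rewrite /Y; nra.
exists Y, th; split => //; elim=> [|N IH] i.
  rewrite expr0 mulr1 (le_trans (ler_normB _ _)) // (le_trans (lerD (GC _) (GC _))) //.
  have Y2 : 2 * C <= Y by rewrite lerDr divr_ge0 // subr_ge0 ltW.
  by rewrite /Defs.weight /=; have := zi i; nra.
set e := iter N pstep G in IH.
pose a := phi (i, true).
have ab : mu1 m <= a <= mu2 m by exact: policy_bounds.
(* Arrivals act alike on both sides; the mismatch of the service rates [mu] and [a] leaves the
   increment at (i,0). *)
have -> : iter N.+1 pstep G (i, false) - iter N.+1 pstep G (i, true) =
    qstep m a (fun j => e (j, false) - e (j, true)) i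
    - (mu m - a) * queue_increment e (i, false).
  by rewrite /qstep /a /e /=; case: i {a ab} => [|i] /=; ring.
have qb := qstep_norm hzeta i ab IH.
have ib : `|(mu m - a) * queue_increment e (i, false)| <= C * th ^+ N * zeta ^+ i.
  rewrite normrM; apply: (@le_trans _ _ (1 * (eta ^+ N * (C * 2) * weight (i, false)))).
    apply: ler_pM => //; last exact: queue_increment_iter.
    by rewrite ler_norml; move: ab => /andP[? ?]; apply/andP; split; lra.
  rewrite /Defs.weight /=.
  have -> : 1 * (eta ^+ N * (C * 2) * (zeta ^+ i / 2)) = C * eta ^+ N * zeta ^+ i by field.
  rewrite ler_wpM2r ?(ltW (zi _)) // ler_wpM2l //.
  by rewrite lerXn2r // nnegrE; lra.
rewrite (le_trans (ler_normB _ _)) // (le_trans (lerD qb ib)) //.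
rewrite -mulrDl ler_wpM2r ?(ltW (zi _)) // exprS.
have tN : 0 < th ^+ N by rewrite exprn_gt0 //; case/andP: th1.
by nra.
Qed.

End Decoupling.

(** * Saved costs *)

Lemma cvg_geometric_bound (R : realType) (u : nat -> R) (l c q : R) : 0 < q < 1 ->
  (forall n, `|u n - l| <= c * q ^+ n) -> (u @ \oo --> l)%classic.
Proof.
move=> /andP[q0 q1] ub; have cg : ((fun n => c * q ^+ n) @ \oo --> (0 : R))%classic.
  by apply: cvg_geometric; rewrite ger0_norm // ltW.
apply: (@squeeze_cvgr _ _ _ _ (fun n => l - c * q ^+ n) (fun n => l + c * q ^+ n)).
- by apply: nearW => n; have := ub n; rewrite ler_distl.
- by rewrite -[X in (_ --> X)%classic]subr0; apply: cvgB => //; exact: cvg_cst.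
- by rewrite -[X in (_ --> X)%classic]addr0; apply: cvgD => //; exact: cvg_cst.
Qed.

Lemma srv_ge0 (R : realType) (m : model R) phi x : policies m phi -> 0 <= srv m (phi x).
Proof.
have sm : 0 <= srv m (mu m).
  by case: (mu_action m) => ->; rewrite ?srv_mu1 // ltW ?srv_mu2.
case: x => i [] [aT aF]; last by rewrite aF.
by case: (aT i) => ->; rewrite ?srv_mu1 // ltW ?srv_mu2.
Qed.

Lemma cost_ge0 (R : realType) (m : model R) phi x : policies m phi ->
  0 <= cost m phi x.
Proof. by move=> pphi; rewrite addr_ge0 ?hold_ge0 ?srv_ge0. Qed.

Lemma mean_cost_ge0 (R : realType) (m : model R) phi n x : policies m phi ->
  0 <= iter n (pstep m phi) (cost m phi) x.
Proof.
move=> pphi; elim: n x => [|n IH] x; first exact: cost_ge0.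
exact: pstep_ge0.
Qed.

Lemma expected_costE (R : realType) (m : model R) phi q p n : policies m phi ->
  (forall i, 0 <= p i) ->
  expected_cost m phi (init_dist q p) n =
  (\esum_(i in [set: nat]) (p i * iter n (pstep m phi) (cost m phi) (i, q))%:E)%E.
Proof.
move=> pphi p0.
have i0 x : 0 <= init_dist q p x by rewrite /init_dist; case: ifP.
rewrite /expected_cost esum_law //; last by move=> y; exact: cost_ge0.
rewrite -(@reindex_esum _ _ _ setT [set x | x.2 = q] (fun i => (i, q))
  (fun x => (p x.1 * iter n (pstep m phi) (cost m phi) x)%:E)); last first.
  split => [i _ //|i j _ _ [] //|[i q'] /= ->]; by exists i.
rewrite [RHS]esum_mkcond; apply: eq_esum => -[i q'] _; rewrite /init_dist /=.
case: eqP => [->|qq']; first by rewrite mem_set.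
by rewrite memNset ?mul0r // => /= /qq'.
Qed.

Lemma expected_cost_dirac (R : realType) (m : model R) phi q i n : policies m phi ->
  expected_cost m phi (init_dist q (dirac_dist R i)) n =
  (iter n (pstep m phi) (cost m phi) (i, q))%:E.
Proof.
move=> pphi; rewrite expected_costE //.
rewrite (_ : (\esum_(j in _) _)%E = (\esum_(j in [set i]) 
  (iter n (pstep m phi) (cost m phi) (j, q))%:E)%E).
  by rewrite esum_set1 // lee_fin mean_cost_ge0.
rewrite [RHS]esum_mkcond; apply: eq_esum => j _; rewrite in_set1 /dirac_dist.
by case: eqP; rewrite ?mul1r ?mul0r.
Qed.

Section SavedCost.
Variables (R : realType) (m : model R) (zeta : R).
Hypothesis hzeta : admissible_weight m zeta.
Local Notation weight := (weight zeta).

Definition stat_mean (f : nat -> R) : R := limn (series (fun i => stat_dist m i * f i)).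

Lemma stat_dist_ge0 i : 0 <= stat_dist m i.
Proof.
have r1 := rho_lt1 m; have r0 := rho_gt0 m.
by rewrite mulr_ge0 ?exprn_ge0 ?subr_ge0 // ltW.
Qed.

Lemma stat_mean_cvg f C : (forall i, `|f i| <= C * zeta ^+ i) ->
  cvgn (series (fun i => stat_dist m i * f i)).
Proof.
move=> fC; apply: normed_cvg.
apply: (@series_le_cvg _ _ (geometric ((1 - rho m) * C) (rho m * zeta))).
- by move=> i; exact: normr_ge0.
- move=> i; apply: le_trans (normr_ge0 (stat_dist m i * f i)) _.
  rewrite normrM ger0_norm ?stat_dist_ge0 // (le_trans (ler_wpM2l _ (fC i))) ?stat_dist_ge0 //.
  by rewrite /= exprMn /stat_dist; lra.
- move=> i /=; rewrite normrM ger0_norm ?stat_dist_ge0 //.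
  rewrite (le_trans (ler_wpM2l _ (fC i))) ?stat_dist_ge0 //.
  by rewrite exprMn /stat_dist; lra.
- apply: is_cvg_geometric_series.
  by rewrite ger0_norm ?rhozeta_lt1 // ltW ?rhozeta_gt0.
Qed.

Lemma stat_mean_le f g C D : (forall i, `|f i| <= C * zeta ^+ i) ->
  (forall i, `|g i| <= D * zeta ^+ i) -> (forall i, f i <= g i) ->
  stat_mean f <= stat_mean g.
Proof.
move=> fC gD fg; apply: lim_series_le; [exact: stat_mean_cvg fC|exact: stat_mean_cvg gD|].
by move=> i; rewrite ler_wpM2l ?stat_dist_ge0.
Qed.

Lemma stat_meanD f g C D : (forall i, `|f i| <= C * zeta ^+ i) ->
  (forall i, `|g i| <= D * zeta ^+ i) ->
  stat_mean (fun i => f i + g i) = stat_mean f + stat_mean g.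
Proof.
move=> fC gD; rewrite -lim_seriesD; [|exact: stat_mean_cvg fC|exact: stat_mean_cvg gD].
by congr (limn (series _)); apply/funext => i; rewrite mulrDr.
Qed.

Lemma stat_meanB f g C D : (forall i, `|f i| <= C * zeta ^+ i) ->
  (forall i, `|g i| <= D * zeta ^+ i) ->
  stat_mean (fun i => f i - g i) = stat_mean f - stat_mean g.
Proof.
move=> fC gD; rewrite -lim_seriesB; [|exact: stat_mean_cvg fC|exact: stat_mean_cvg gD].
by congr (limn (series _)); apply/funext => i; rewrite mulrBr.
Qed.

Lemma stat_meanZ c : stat_mean (fun i => c * zeta ^+ i) = c * stat_mean (fun i => zeta ^+ i).
Proof.
have cz : cvgn (series (fun i => stat_dist m i * zeta ^+ i)).
  apply: (@stat_mean_cvg _ 1) => i; rewrite mul1r ger0_norm // ltW //.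
  exact: (expz_gt0 hzeta).
rewrite /stat_mean -[RHS](lim_seriesZ c cz).
by congr (limn (series _)); apply/funext => i; rewrite mulrCA.
Qed.

Lemma stat_mean_norm f C : (forall i, `|f i| <= C * zeta ^+ i) ->
  `|stat_mean f| <= C * stat_mean (fun i => zeta ^+ i).
Proof.
move=> fC; have zi i := ltW (expz_gt0 hzeta i).
have C0 : 0 <= C by have := fC 0%N; rewrite expr0 mulr1; exact: le_trans.
have b c i : `|c * zeta ^+ i| <= `|c| * zeta ^+ i by rewrite normrM (ger0_norm (zi i)).
rewrite ler_norml -mulNr -!stat_meanZ; apply/andP; split.
  apply: (stat_mean_le (b (- C)) fC) => i.
  by have := fC i; rewrite mulNr ler_norml => /andP[].
apply: (stat_mean_le fC (b C)) => i.
by have := fC i; rewrite ler_norml => /andP[].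
Qed.

Variables (phi : state -> R) (c g : R) (G : state -> R) (C : R).
Hypothesis pphi : policies m phi.
Hypothesis cost_le : forall x, `|cost m phi x| <= c * zeta ^+ x.1.
Hypothesis GC : forall x, `|G x| <= C * weight x.
Hypothesis poisson : forall x, g + G x = cost m phi x + pstep m phi G x.

Let meanc n x := iter n (pstep m phi) (cost m phi) x.

Lemma mean_cost_le n x : `|meanc n x| <= c * zeta ^+ n * zeta ^+ x.1.
Proof.
rewrite /meanc; elim: n x => [|n IH] x; first by rewrite expr0 mulr1; exact: cost_le.
by rewrite exprSr mulrA; exact: (pstep_growth hzeta x pphi IH).
Qed.

Lemma expected_cost_stat q n : expected_cost m phi (init_dist q (stat_dist m)) n =
  (stat_mean (fun i => meanc n (i, q)))%:E.
Proof.
rewrite expected_costE //; last exact: stat_dist_ge0.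
rewrite -nneseries_esumT => [|i]; last first.
  by rewrite lee_fin mulr_ge0 ?stat_dist_ge0 ?mean_cost_ge0.
rewrite -EFin_lim; last exact: stat_mean_cvg (fun i => mean_cost_le n (i, q)).
by congr (limn _); apply/funext => N /=; rewrite sumEFin.
Qed.

Lemma saved_cost_limit p a b l :
  (forall n, expected_cost m phi (init_dist false p) n = (a n)%:E) ->
  (forall n, expected_cost m phi (init_dist true p) n = (b n)%:E) ->
  ((fun N => \sum_(0 <= n < N) (a n - b n)) @ \oo --> l)%classic ->
  saved_cost m phi p = l%:E.
Proof.
move=> aE bE abl; rewrite /saved_cost -(cvg_lim _ abl) // -EFin_lim; last first.
  by apply/cvg_ex; exists l.
congr (limn _); apply/funext => N /=.
by rewrite -sumEFin; apply: eq_bigr => n _; rewrite aE bE.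
Qed.

(** Both starting states have the same average cost [g], so the terms linear in [N] cancel. *)
Lemma sum_mean_cost_diff N i :
  \sum_(0 <= n < N) (meanc n (i, false) - meanc n (i, true)) =
  G (i, false) - G (i, true)
  - (iter N (pstep m phi) G (i, false) - iter N (pstep m phi) G (i, true)).
Proof.
by rewrite sumrB !(cumulated_poisson _ _ poisson); ring.
Qed.

Lemma saved_cost_dirac i :
  saved_cost m phi (dirac_dist R i) = (G (i, false) - G (i, true))%:E.
Proof.
have [Y [th [th1 dec]]] := decoupling hzeta pphi GC.
apply: saved_cost_limit; do ?by move=> n; exact: expected_cost_dirac.
apply: (@cvg_geometric_bound _ _ _ (Y * zeta ^+ i) th th1) => N.
by rewrite sum_mean_cost_diff addrC addKr normrN (le_trans (dec N i)) // mulrAC.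
Qed.

Lemma value_diff_le i : `|G (i, false) - G (i, true)| <= 2 * C * zeta ^+ i.
Proof.
rewrite (le_trans (ler_normB _ _)) // (le_trans (lerD (GC _) (GC _))) //.
have C0 : 0 <= C.
  have := GC (0%N, true); rewrite /Defs.weight /= expr0 mulr1; exact: le_trans.
by rewrite /Defs.weight /=; have := expz_gt0 hzeta i; nra.
Qed.

(** No infinite sums are interchanged: for fixed [N] the finite sum over time commutes with
    [stat_mean], and the decoupling error, uniform against [zeta ^+ i], is then integrated. *)
Lemma saved_cost_stat :
  saved_cost m phi (stat_dist m) = (stat_mean (fun i => G (i, false) - G (i, true)))%:E.
Proof.
have [Y [th [th1 dec]]] := decoupling hzeta pphi GC.
apply: saved_cost_limit; do ?by move=> n; exact: expected_cost_stat.
apply: (@cvg_geometric_bound _ _ _ (Y * stat_mean (fun i => zeta ^+ i)) th th1) => N.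
have bnd n i : `|meanc n (i, false) - meanc n (i, true)| <= 2 * c * zeta ^+ n * zeta ^+ i.
  rewrite (le_trans (ler_normB _ _)) //.
  by rewrite (le_trans (lerD (mean_cost_le n _) (mean_cost_le n _))) //=; lra.
have psum_le M i : `|\sum_(0 <= n < M) (meanc n (i, false) - meanc n (i, true))|
    <= (2 * C + Y * th ^+ M) * zeta ^+ i.
  rewrite sum_mean_cost_diff (le_trans (ler_normB _ _)) //.
  by rewrite mulrDl lerD ?value_diff_le.
have partial M : (\sum_(0 <= n < M)
      (stat_mean (fun i => meanc n (i, false)) - stat_mean (fun i => meanc n (i, true)))
    = stat_mean (fun i => \sum_(0 <= n < M) (meanc n (i, false) - meanc n (i, true)))).
  elim: M => [|M IH].
    rewrite big_nil (_ : (fun i => _) = fun i => 0 * zeta ^+ i) ?stat_meanZ ?mul0r //.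
    by apply/funext => i; rewrite big_nil mul0r.
  rewrite big_nat_recr //= IH -(stat_meanB (fun i => mean_cost_le M (i, false))
    (fun i => mean_cost_le M (i, true))) -(stat_meanD (psum_le M) (bnd M)).
  by congr stat_mean; apply/funext => i; rewrite big_nat_recr.
rewrite partial -(stat_meanB (psum_le N) value_diff_le) mulrAC.
apply: stat_mean_norm => i.
by rewrite sum_mean_cost_diff addrC addKr normrN (le_trans (dec N i)).
Qed.

End SavedCost.

(** * Policy values and value iteration *)

Section PolicyValue.
Variables (R : realType) (m : model R) (zeta uM : R) (H : state -> R).
Hypothesis hzeta : admissible_weight m zeta.
Hypothesis hH : relative_value m zeta H.
Hypothesis huM : cost_bound m zeta uM.
Local Notation policies := (policies m).
Local Notation eta := (Defs.eta m zeta).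
Local Notation weight := (weight zeta).
Local Notation gam := ((1 - bet m) * zeta).
Local Notation K := (Ktilde m zeta uM).

Lemma wnorm_le f C : (wnorm zeta f <= C%:E)%E -> forall x, `|f x| <= C * weight x.
Proof.
move=> fC x; rewrite -ler_pdivrMr ?(weight_gt0 hzeta) // -lee_fin.
by apply: le_trans fC; apply: ereal_sup_ubound; exists x.
Qed.

Lemma cost_le phi x : policies phi -> `|cost m phi x| <= uM * weight x.
Proof.
move=> pphi; apply: wnorm_le; move: huM; rewrite /cost_bound ge_max => /andP[+ _].
by apply: le_trans; apply: ereal_sup_ubound; exists phi.
Qed.

Lemma gmu_ge0 : 0 <= gmu m.
Proof.
rewrite addr_ge0 //.
  by case: (mu_action m) => ->; rewrite ?srv_mu1 // ltW ?srv_mu2.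
rewrite mulr_ge0 ?subr_ge0 ?(ltW (rho_lt1 m)) //; apply: limr_ge.
  by apply: hold_summable; rewrite rho_gt0 rho_lt1.
apply: nearW => n; apply: sumr_ge0 => i _.
by rewrite mulr_ge0 ?hold_ge0 // exprn_ge0 // ltW ?rho_gt0.
Qed.

(** The cost and [gmu] both lie between 0 and [uM * weight x], hence so does the absolute value of
    their difference, without a factor 2. *)
Lemma centred_cost_le phi x : policies phi -> `|cost m phi x - gmu m| <= uM * weight x.
Proof.
move=> pphi; have cM := cost_le x pphi; have c0 := cost_ge0 x pphi; have g0 := gmu_ge0.
have gM : `|gmu m| <= uM * weight x.
  apply: (wnorm_le (f := fun=> gmu m)).
  by move: huM; rewrite /cost_bound ge_max => /andP[].
move: cM gM; rewrite (ger0_norm c0) (ger0_norm g0) => ? ?; rewrite ler_norml; apply/andP; split; lra.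
Qed.

Lemma phi0_policy : policies (phi0 m).
Proof. by split => [i|//]; exact: mu_action. Qed.

Lemma uM_gt0 : 0 < uM.
Proof.
pose phi (x : state) := if x.2 then mu2 m else mu m.
have pphi : policies phi by split => [i|//]; right.
have := cost_le (0%N, true) pphi; rewrite /cost /Defs.weight /= expr0 mulr1 hold0 addr0.
by apply: lt_le_trans; rewrite gtr0_norm srv_mu2.
Qed.

Lemma H_bounded : exists2 C, 0 <= C & forall x, `|H x| <= C * weight x.
Proof.
case: hH => Hfin _ _; have H0 : (0 <= wnorm zeta H)%E.
  apply: (@le_trans _ _ (`|H (0%N, true)| / weight (0%N, true))%:E).
    by rewrite lee_fin divr_ge0 // ltW ?(weight_gt0 hzeta).
  by apply: ereal_sup_ubound; exists (0%N, true).
have Hf : wnorm zeta H \is a fin_num by rewrite ge0_fin_numE.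
exists (fine (wnorm zeta H)); first exact: fine_ge0.
by apply: wnorm_le; rewrite fineK.
Qed.

Lemma H_le phi x : policies phi -> gmu m + H x <= cost m phi x + pstep m phi H x.
Proof. by move=> pphi; case: hH => _ _ /(_ x) [/(_ _ pphi)]; rewrite sum_trans. Qed.

Lemma H_attained x :
  exists2 phi, policies phi & gmu m + H x = cost m phi x + pstep m phi H x.
Proof.
by case: hH => _ _ /(_ x) [_ [phi pphi]]; rewrite sum_trans; exists phi.
Qed.

(** The killed chain contracts at rate [eta], so iteration removes the a priori constant [C]. The
    policy may depend on the state, which covers the optimality equation and the evaluation of one
    policy alike. *)
Lemma taboo_bound G C x : 0 <= C -> (forall y, `|G y| <= C * weight y) ->
  G (0%N, false) = 0 ->
  (forall y, exists2 phi, policies phi & gmu m + G y = cost m phi y + pstep m phi G y) ->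
  `|G x| <= uM / (1 - eta) * weight x.
Proof.
move=> C0 GC G0 GE; have e0 := eta_gt0 hzeta; have e1 := eta_lt1 hzeta.
have u0 := uM_gt0; have w0 := weight_gt0 hzeta.
have ue : 0 <= uM / (1 - eta) by rewrite divr_ge0 ?ltW // subr_gt0.
have it n y : `|G y| <= (uM / (1 - eta) + C * eta ^+ n) * weight y.
  elim: n y => [|n IH] y.
    by rewrite expr0 mulr1 (le_trans (GC y)) // ler_wpM2r ?lerDr // ltW.
  have [phi pphi Gy] := GE y.
  have -> : G y = (cost m phi y - gmu m) + pstep m phi G y by lra.
  have D0 : 0 <= uM / (1 - eta) + C * eta ^+ n.
    by rewrite addr_ge0 // mulr_ge0 // exprn_ge0 // ltW.
  have := pstep_killed hzeta y pphi D0 G0 IH.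
  have := centred_cost_le y pphi => b1 b2.
  rewrite (le_trans (ler_normD _ _)) // (le_trans (lerD b1 b2)) // -mulrDl.
  rewrite ler_wpM2r ?(ltW (w0 _)) // exprS le_eqVlt; apply/orP; left; apply/eqP.
  by field; rewrite subr_eq0 gt_eqF.
apply: (@le_of_geometric _ _ _ (C * weight x) eta); first by rewrite e0.
by move=> n; rewrite (le_trans (it n x)) // mulrDl (mulrAC C).
Qed.

Lemma H_norm x : `|H x| <= uM / (1 - eta) * weight x.
Proof.
have [C C0 HC] := H_bounded.
by apply: (taboo_bound x C0 HC); [case: hH|exact: H_attained].
Qed.

(** Passing to (i,0) ends the controlled phase, so the policy-independent value [H (i, false)]
    enters as a cost of rate [bet]. *)
Definition stage_reward (a : R) (i : nat) : R :=
  srv m a + hold m i - gmu m + bet m * H (i, false).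

Lemma stage_valueE V i a : stage_value m H V i a = stage_reward a i + qstep m a V i.
Proof. by rewrite /stage_value /stage_reward /qstep; ring. Qed.

Lemma K_gt0 : 0 < K.
Proof.
have [? ? ? ? ?] := rates m; have e1 := eta_lt1 hzeta; have u0 := uM_gt0.
rewrite addr_gt0 ?ltr_wpDl ?gmu_ge0 // divr_gt0 ?subr_gt0 //; exact: mulr_gt0.
Qed.

Lemma stage_reward_le phi i : policies phi ->
  `|stage_reward (phi (i, true)) i| <= K * zeta ^+ i.
Proof.
move=> pphi; have zi := expz_gt0 hzeta i; have g0 := gmu_ge0; have u0 := uM_gt0.
have [? b0 ? ? ?] := rates m; have e1 := eta_lt1 hzeta.
have := centred_cost_le (i, true) pphi; have := H_norm (i, false).
rewrite /stage_reward /cost /Defs.weight /=; set r := _ - gmu m => Hb rb.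
rewrite (le_trans (ler_normD _ _)) //.
rewrite (le_trans (lerD rb (normrM_le (ltW b0) Hb))) // /Ktilde.
have q0 : 0 < uM / (1 - eta) by rewrite divr_gt0 // subr_gt0.
have p1 : 0 < bet m * (uM / (1 - eta)) * zeta ^+ i by rewrite mulr_gt0 // (mulr_gt0 b0).
have p2 : 0 <= gmu m * zeta ^+ i by rewrite mulr_ge0 // ltW.
by rewrite -(mulrA (bet m) uM); lra.
Qed.

Section FixedPolicy.
Variable phi : state -> R.
Hypothesis pphi : policies phi.
Local Notation B V i := (stage_value m H V i (phi (i, true))).

Let U n : nat -> R := iter n (fun V i => B V i) (fun=> 0).

Let U_diff n i : `|U n.+1 i - U n i| <= K * gam ^+ n * zeta ^+ i.
Proof.
rewrite /U; elim: n i => [|n IH] i.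
  rewrite /= stage_valueE /qstep !mulr0 !addr0 subr0 expr0 mulr1; exact: stage_reward_le.
rewrite [X in `|X|](_ : _ = qstep m (phi (i, true)) (fun j => U n.+1 j - U n j) i).
  rewrite (le_trans (qstep_norm hzeta i (policy_bounds i pphi) IH)) //.
  by rewrite exprS; lra.
by rewrite qstepB /U /= !stage_valueE; ring.
Qed.

Let Kgam_ge0 : 0 <= K / (1 - gam).
Proof. by rewrite divr_ge0 ?(ltW K_gt0) // subr_ge0 ltW ?(gam_lt1 hzeta). Qed.

Let U_le n i : `|U n i| <= K / (1 - gam) * zeta ^+ i.
Proof.
have zi := expz_gt0 hzeta; elim: n i => [|n IH] i.
  by rewrite /U /= normr0 mulr_ge0 ?(ltW (zi _)).
rewrite /U /= stage_valueE (le_trans (ler_normD _ _)) //.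
have := qstep_norm hzeta i (policy_bounds i pphi) IH.
have := stage_reward_le i pphi => b1 b2; rewrite (le_trans (lerD b1 b2)) // -mulrDl.
rewrite ler_wpM2r ?(ltW (zi _)) // le_eqVlt; apply/orP; left; apply/eqP.
by field; rewrite subr_eq0 gt_eqF ?(gam_lt1 hzeta).
Qed.

Let U_cvg i : cvgn (fun n => U n i).
Proof.
have -> : (fun n => U n i) = series (fun n => U n.+1 i - U n i).
  by apply/funext => n; rewrite /series /= telescope_sumr // /U /= subr0.
apply: normed_cvg.
apply: (@series_le_cvg _ _ (geometric (K * zeta ^+ i) gam)).
- by move=> n; exact: normr_ge0.
- move=> n /=; rewrite mulr_ge0 ?mulr_ge0 ?exprn_ge0 //.
  + exact: ltW K_gt0.
  + by rewrite ltW ?(zeta_gt0 hzeta).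
  + by rewrite ltW ?(gam_gt0 hzeta).
- by move=> n /=; rewrite (le_trans (U_diff n i)) // mulrAC.
- by apply: is_cvg_geometric_series; rewrite ger0_norm ?(gam_lt1 hzeta) // ltW ?(gam_gt0 hzeta).
Qed.

(** The contraction principle by hand: the iterates from 0 have geometrically small increments, and
    the evaluation equation passes to the pointwise limit because it involves only three values of
    [V]. *)
Lemma policy_value_exists : exists V : nat -> R,
  (forall i, V i = B V i) /\ (forall i, `|V i| <= K / (1 - gam) * zeta ^+ i).
Proof.
exists (fun i => limn (fun n => U n i)); split => i; last first.
  have Ub n := U_le n i; rewrite ler_norml; apply/andP; split.
    apply: limr_ge; first exact: U_cvg.
    by apply: nearW => n; have := Ub n; rewrite ler_norml => /andP[].
  apply: limr_le; first exact: U_cvg.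
  by apply: nearW => n; have := Ub n; rewrite ler_norml => /andP[].
apply: cvg_lim => //; rewrite -(@cvg_shiftS _ (fun n => U n i)) /=.
rewrite stage_valueE.
rewrite (_ : (fun n => U n.+1 i) = fun n => stage_reward (phi (i, true)) i + qstep m (phi (i, true)) (U n) i); last first.
  by apply/funext => n; rewrite -stage_valueE.
apply: cvgD; first exact: cvg_cst.
rewrite /qstep; apply: cvgD; [apply: cvgD|]; apply: cvgMl_tmp; exact: U_cvg.
Qed.

End FixedPolicy.
End PolicyValue.

(** * Optimality of [H] among policy values *)

Section Optimality.
Variables (R : realType) (m : model R) (zeta uM : R) (H : state -> R).
Hypothesis hzeta : admissible_weight m zeta.
Hypothesis hH : relative_value m zeta H.
Hypothesis huM : cost_bound m zeta uM.
Local Notation policies := (policies m).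
Local Notation eta := (Defs.eta m zeta).
Local Notation weight := (weight zeta).
Local Notation gam := ((1 - bet m) * zeta).
Local Notation K := (Ktilde m zeta uM).
Local Notation H1 := (fun i : nat => H (i, true)).

Definition is_policy_value (phi : state -> R) (V : nat -> R) :=
  (forall i, V i = stage_value m H V i (phi (i, true))) /\
  (forall i, `|V i| <= K / (1 - gam) * zeta ^+ i).

(** The relative value function of a policy, normalised to vanish at (0,0); on the states (i,0) all
    policies share the values of [H]. *)
Definition extend_value (V : nat -> R) (x : state) : R := if x.2 then V x.1 else H x.

Lemma extend_value_poisson phi V : policies phi -> is_policy_value phi V ->
  forall x, gmu m + extend_value V x = cost m phi x + pstep m phi (extend_value V) x.
Proof.
move=> pphi [VE _] [i []].
  by rewrite /extend_value /= /cost [in LHS]VE /stage_value /=; lra.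
have [psi ppsi] := H_attained hH (i, false).
by rewrite /cost !(ppsi.2, pphi.2) /extend_value.
Qed.

Lemma H1_le phi i : policies phi -> H1 i <= stage_value m H H1 i (phi (i, true)).
Proof. by move=> pphi; have := H_le hH (i, true) pphi; rewrite /cost /stage_value /=; lra. Qed.

Lemma H1_attained i :
  exists2 phi, policies phi & H1 i = stage_value m H H1 i (phi (i, true)).
Proof.
have [phi pphi E] := H_attained hH (i, true); exists phi => //.
by move: E; rewrite /cost /stage_value /=; lra.
Qed.

(** Replaces the a priori constant [K / (1 - gam)] by [uM / (1 - eta)], the constant for which
    [ktilde] is tuned. *)
Lemma extend_value_norm phi V x : policies phi -> is_policy_value phi V ->
  `|extend_value V x| <= uM / (1 - eta) * weight x.
Proof.
move=> pphi Vphi; have u0 := uM_gt0 hzeta huM; have w0 := weight_gt0 hzeta.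
have a0 : 0 <= uM / (1 - eta) by rewrite divr_ge0 ?subr_ge0 // ltW ?(eta_lt1 hzeta).
have b0 : 0 <= K / (1 - gam).
  by rewrite divr_ge0 ?subr_ge0 ?(ltW (K_gt0 hzeta huM)) // ltW ?(gam_lt1 hzeta).
apply: (taboo_bound hzeta huM (C := uM / (1 - eta) + K / (1 - gam))).
- exact: addr_ge0.
- move=> -[i []]; rewrite mulrDl /extend_value /=.
    by rewrite (le_trans (Vphi.2 i)) // /Defs.weight /= lerDr mulr_ge0 // ltW ?(expz_gt0 hzeta).
  by rewrite (le_trans (H_norm hzeta hH huM _)) // lerDl mulr_ge0 // ltW.
- by rewrite /extend_value /=; case: hH.
- by move=> y; exists phi => //; exact: extend_value_poisson.
Qed.

(** The difference of the two sides is a subsolution of the homogeneous equation for the actions of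
    [phi], so [qstep_subfix] applies with [b = 0]. *)
Lemma H1_le_policy_value phi V i : policies phi -> is_policy_value phi V -> H1 i <= V i.
Proof.
move=> pphi [VE VK]; rewrite -subr_le0.
rewrite -(mul0r (zeta ^+ i)) -[X in X * _](mul0r (1 - gam)^-1).
apply: (qstep_subfix hzeta (act := fun j => phi (j, true)) (u := fun j => H1 j - V j)
  (C := uM / (1 - eta) + K / (1 - gam))) => //.
- by move=> j; exact: policy_bounds.
- move=> j; have := H_norm hzeta hH huM (j, true); have := VK j.
  by rewrite /Defs.weight /= mulrDl !ler_norml => /andP[? ?] /andP[? ?]; lra.
- move=> j; rewrite mul0r add0r qstepB; have := H1_le j pphi; have := VE j.
  by rewrite !stage_valueE => -> /=; lra.
Qed.

Lemma saved_cost_dirac_value phi V i : policies phi -> is_policy_value phi V ->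
  saved_cost m phi (dirac_dist R i) = (H (i, false) - V i)%:E.
Proof.
move=> pphi Vphi.
exact: (saved_cost_dirac hzeta pphi (fun x => extend_value_norm x pphi Vphi)
  (extend_value_poisson pphi Vphi)).
Qed.

Lemma saved_cost_stat_value phi V : policies phi -> is_policy_value phi V ->
  saved_cost m phi (stat_dist m) = (stat_mean m (fun i => H (i, false) - V i))%:E.
Proof.
move=> pphi Vphi; have u0 := uM_gt0 hzeta huM; have zi := expz_gt0 hzeta.
have costM x : `|cost m phi x| <= uM * zeta ^+ x.1.
  rewrite (le_trans (cost_le hzeta huM x pphi)) // ler_wpM2l ?(ltW u0) //.
  by rewrite /Defs.weight; case: ifP => // _; have := zi x.1; lra.
exact: (saved_cost_stat hzeta pphi costM (fun x => extend_value_norm x pphi Vphi)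
  (extend_value_poisson pphi Vphi)).
Qed.

(** * Error bounds for value iteration *)

Section ValueIterationBounds.
Variable tphi : nat -> nat -> R.
Hypothesis htphi : stage_optimal m H tphi.
Local Notation W := (Vdisc m H).

Definition greedy_policy n (x : state) : R := if x.2 then tphi n x.1 else mu m.

Lemma greedy_policyP n : policies (greedy_policy n).
Proof. by split => // i; exact: htphi.1. Qed.

Lemma Vdisc_le phi n i : policies phi ->
  W n.+1 i <= stage_value m H (W n) i (phi (i, true)).
Proof. by move=> [/(_ i) + _] /=; rewrite ge_min => -[] ->; rewrite lexx ?orbT. Qed.

Lemma Vdisc_greedy n i :
  W n.+1 i = stage_value m H (W n) i (greedy_policy n.+1 (i, true)).
Proof. by rewrite -[LHS](htphi.2). Qed.

(** Consecutive minima are compared through each other's minimisers: the actions of one stage give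
    the upper bound, those of the next the lower one. *)
Lemma Vdisc_diff n i : `|W n.+1 i - W n i| <= K * gam ^+ n * zeta ^+ i.
Proof.
elim: n i => [|n IH] i.
  rewrite Vdisc_greedy stage_valueE /qstep /= !mulr0 !addr0 subr0 expr0 mulr1.
  exact: (stage_reward_le hzeta hH huM _ (greedy_policyP 1)).
rewrite ler_distlC; set d := K * _ * _.
have bd k : `|qstep m (greedy_policy k (i, true)) (fun j => W n.+1 j - W n j) i| <= d.
  rewrite (le_trans (qstep_norm hzeta i (policy_bounds i (greedy_policyP k)) IH)) //.
  by rewrite /d exprS; lra.
have := Vdisc_le n i (greedy_policyP n.+2).
have := Vdisc_le n.+1 i (greedy_policyP n.+1).
rewrite (Vdisc_greedy n i) (Vdisc_greedy n.+1 i).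
have := bd n.+1; have := bd n.+2.
rewrite !qstepB !stage_valueE !ler_norml => /andP[? ?] /andP[? ?] ? ?.
by apply/andP; split; lra.
Qed.

Let Kgam_ge0 : 0 <= K / (1 - gam).
Proof.
by rewrite divr_ge0 ?subr_ge0 ?(ltW (K_gt0 hzeta huM)) // ltW ?(gam_lt1 hzeta).
Qed.

Lemma Vdisc_norm n i : `|W n i| <= K / (1 - gam) * zeta ^+ i.
Proof.
have zi := expz_gt0 hzeta; elim: n i => [|n IH] i.
  by rewrite /= normr0 mulr_ge0 ?(ltW (zi _)).
rewrite Vdisc_greedy stage_valueE (le_trans (ler_normD _ _)) //.
have b1 := stage_reward_le hzeta hH huM i (greedy_policyP n.+1).
have b2 := qstep_norm hzeta i (policy_bounds i (greedy_policyP n.+1)) IH.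
rewrite (le_trans (lerD b1 b2)) // -mulrDl.
rewrite ler_wpM2r ?(ltW (zi _)) // le_eqVlt; apply/orP; left; apply/eqP.
by field; rewrite subr_eq0 gt_eqF ?(gam_lt1 hzeta).
Qed.

(** [V - W n.+1] solves the evaluation equation with source [qstep (W n.+1 - W n)], which is of
    order [gam ^+ n.+1]. *)
Lemma greedy_value_le_Vdisc n V i : is_policy_value (greedy_policy n) V ->
  V i - W n i <= K * gam ^+ n / (1 - gam) * zeta ^+ i.
Proof.
move=> [VE VK]; case: n VE => [|n] VE.
  (* With no stages [W 0] is zero and the actions are arbitrary, so only the a priori bound on [V]
     is available. *)
  by rewrite expr0 mulr1 subr0 (le_trans (ler_norm _)).
apply: (qstep_subfix hzeta (act := fun j => greedy_policy n.+1 (j, true))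
  (u := fun j => V j - W n.+1 j) (C := 2 * (K / (1 - gam)))) => //.
- by move=> j; apply: policy_bounds; exact: greedy_policyP.
- by rewrite mulr_ge0 ?(ltW (K_gt0 hzeta huM)) // exprn_ge0 // ltW ?(gam_gt0 hzeta).
- move=> j; have := Vdisc_norm n.+1 j; have := VK j.
  by rewrite !ler_norml => /andP[? ?] /andP[? ?]; lra.
- move=> j; have ab := policy_bounds j (greedy_policyP n.+1).
  have := qstep_norm hzeta j ab (Vdisc_diff n); rewrite ler_norml => /andP[_].
  rewrite !qstepB VE Vdisc_greedy !stage_valueE exprS.
  by lra.
Qed.

Lemma Vdisc_le_H1 n i : W n i - H1 i <= K * gam ^+ n / (1 - gam) * zeta ^+ i.
Proof.
have zi := expz_gt0 hzeta; have g0 := gam_gt0 hzeta; have g1 := gam_lt1 hzeta.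
elim: n i => [|n IH] i.
  rewrite expr0 mulr1 /= sub0r; have := H_norm hzeta hH huM (i, true).
  rewrite /Defs.weight /= ler_norml => /andP[+ _]; rewrite lerNl => h.
  apply: le_trans h _; rewrite ler_wpM2r ?(ltW (zi _)) //.
  have [? b0 ? ? ?] := rates m; have e1 := eta_lt1 hzeta; have u0 := uM_gt0 hzeta huM.
  have gm := gmu_ge0 m; have z1 := zeta_gt1 hzeta.
  have q0 : 0 < uM / (1 - eta) by rewrite divr_gt0 // subr_gt0.
  rewrite ler_pdivlMr ?subr_gt0 // /Ktilde -(mulrA (bet m)).
  (* By [zeta > 1]; hence [K / (1 - gam)] dominates [K / bet], and so the bound [uM / (1 - eta)] on
     [H]. *)
  have : 1 - gam <= bet m by nra.
  by nra.
have [phi pphi E] := H1_attained i.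
have Kn : 0 <= K * gam ^+ n / (1 - gam).
  by rewrite mulrAC mulr_ge0 // exprn_ge0 // ltW.
have step : W n.+1 i - H1 i <= qstep m (phi (i, true)) (fun j => W n j - H1 j) i.
  have := Vdisc_le n i pphi; move: E.
  by rewrite qstepB !stage_valueE /=; lra.
rewrite (le_trans step) // (le_trans (qstep_le hzeta i (policy_bounds i pphi) IH Kn)) //.
by rewrite exprS; lra.
Qed.

(** Greedy value against iterate and iterate against optimum contribute equal errors, which is why
    [phik] calls [ntilde] with half its tolerance. *)
Lemma greedy_value_le n V i : is_policy_value (greedy_policy n) V ->
  V i - H1 i <= 2 * K * gam ^+ n / (1 - gam) * zeta ^+ i.
Proof.
move=> /(greedy_value_le_Vdisc i); have := Vdisc_le_H1 n i.
by rewrite -!mulrA; lra.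
Qed.

End ValueIterationBounds.

Lemma opt_saved_cost_le :
  (opt_saved_cost m (stat_dist m) <=
   (stat_mean m (fun i => H (i, false) - H (i, true)))%:E)%E.
Proof.
apply: ge_ereal_sup => _ [phi pphi <-].
have [V Vphi] := policy_value_exists hzeta hH huM pphi.
have HN : forall i, `|H (i, false) - H (i, true)| <= 2 * (uM / (1 - eta)) * zeta ^+ i.
  by move=> i; apply: (value_diff_le hzeta (G := H)) => x; exact: H_norm.
have VN : forall i, `|H (i, false) - V i| <= 2 * (uM / (1 - eta)) * zeta ^+ i.
  move=> i; apply: (value_diff_le hzeta (G := extend_value V)) => x.
  exact: extend_value_norm Vphi.
rewrite (saved_cost_stat_value pphi Vphi) lee_fin.
apply: (stat_mean_le hzeta VN HN) => i.
by rewrite lerD2l lerN2; exact: H1_le_policy_value Vphi.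
Qed.

End Optimality.

(** * Logarithmic thresholds and geometric tails *)

(** Since [b < 1], larger exponents give smaller powers; rounding up and replacing a negative
    exponent by 0 therefore both preserve the bound. *)
Lemma expr_log_ceil (R : realType) (b x : R) : 0 < b < 1 -> 0 < x ->
  b ^+ absz (Num.max 0 (Num.ceil (log_base b x))) <= x.
Proof.
move=> /andP[b0 b1] x0; set n := absz _.
have : log_base b x <= n%:R.
  rewrite (le_trans (ceil_ge _)) // -[n%:R]/(n%:Z%:~R) ler_int /n gez0_abs ?le_max ?lexx //.
  by rewrite orbT.
have lb : ln b < 0 by rewrite ln_lt0 // b0.
rewrite /log_base ler_ndivrMr // mulr_natl -lnXn // ler_ln // posrE //.
exact: exprn_gt0.
Qed.

(** The indicator lets one bound on partial sums serve the full series, with [k = 0], as well as its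
    tail. *)
Lemma geometric_tail (R : realFieldType) (y : R) (k N : nat) : 0 <= y < 1 ->
  \sum_(0 <= i < N) (k <= i)%N%:R * y ^+ i <= y ^+ k / (1 - y).
Proof.
move=> /andP[y0 y1]; rewrite ler_pdivlMr ?subr_gt0 //.
suff -> : (\sum_(0 <= i < N) (k <= i)%N%:R * y ^+ i) * (1 - y) =
    if (k <= N)%N then y ^+ k - y ^+ N else 0.
  by case: ifP => _; rewrite ?exprn_ge0 // lerBlDr lerDl exprn_ge0.
elim: N => [|N IH].
  by rewrite big_nil mul0r; case: k => [|k] //=; rewrite subrr.
rewrite big_nat_recr //= mulrDl IH exprS.
case: (ltngtP k N.+1) => [|kN|->].
- by rewrite ltnS => kN; rewrite kN /=; ring.
- by rewrite leqNgt (ltn_trans _ kN) //= !mul0r addr0.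
- by rewrite ltnn /= exprS; ring.
Qed.

Lemma stat_mean_cond (R : realType) (m : model R) (zeta C : R) (P : pred nat) f :
  admissible_weight m zeta -> (forall i, `|f i| <= C * zeta ^+ i) ->
  (\sum_(0 <= i <oo | P i) (stat_dist m i)%:E * (f i)%:E)%E =
  (stat_mean m (fun i => if P i then f i else 0))%:E.
Proof.
move=> hzeta fC; have zi := expz_gt0 hzeta.
have C0 : 0 <= C by have := fC 0%N; rewrite expr0 mulr1; exact: le_trans.
rewrite eseries_mkcond -EFin_lim; last first.
  apply: (stat_mean_cvg hzeta (C := C)) => i; case: ifP => // _.
  by rewrite normr0 mulr_ge0 // ltW.
congr (limn _); apply/funext => N /=; rewrite -sumEFin; apply: eq_bigr => i _.
by case: ifP => _; rewrite ?mulr0 ?EFinM.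
Qed.

(** * The loss of the truncated policy *)

Unset Implicit Arguments.

Theorem proposition6p2 (R : realType) (m : model R) (zeta uM : R)
    (H : state -> R) (tphi : nat -> nat -> R) (eps : R)
    (hzeta : admissible_weight m zeta)
    (hH : relative_value m zeta H)
    (huM : cost_bound m zeta uM)
    (htphi : stage_optimal m H tphi)
    (heps : 0 < eps) :
  let kt : int := ktilde m zeta uM eps in
  let phi : state -> R := phik m zeta uM tphi (eps / 2) kt in
  (opt_saved_cost m (stat_dist m) - eps%:E <=
     \sum_(0 <= i <oo | (i%:Z <= kt)%R)
        ((stat_dist m i)%:E * saved_cost m phi (dirac_dist R i))
   + \sum_(0 <= i <oo | (kt < i%:Z)%R)
        ((stat_dist m i)%:E * saved_cost m (phi0 m) (dirac_dist R i)))%E.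
Proof.
cbv zeta; set kt := ktilde _ _ _ _; set phi := phik _ _ _ _ _ _.
pose gam : R := (1 - bet m) * zeta; pose eta := Defs.eta m zeta.
pose K := Ktilde m zeta uM; pose y := rho m * zeta; pose B := uM / (1 - eta).
have z1 := zeta_gt1 hzeta; have zi := expz_gt0 hzeta; have e1 : eta < 1 := eta_lt1 hzeta.
have g0 : 0 < gam := gam_gt0 hzeta; have g1 : gam < 1 := gam_lt1 hzeta.
have y0 : 0 < y := rhozeta_gt0 hzeta; have y1 : y < 1 := rhozeta_lt1 hzeta.
have r0 := rho_gt0 m; have r1 := rho_lt1 m.
have u0 := uM_gt0 hzeta huM; have K0 : 0 < K := K_gt0 hzeta huM.
have B0 : 0 < B by rewrite divr_gt0 // subr_gt0.
(* [phi] is the [n]-stage greedy policy; the tolerance is [eps / 4] because [phik] halves [eps / 2]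
   once more. *)
pose n := absz (Num.max 0 (ntilde m zeta uM (eps / 2 / 2) kt)).
have pphi : policies m phi := greedy_policyP htphi n.
have [V1 V1phi] := policy_value_exists hzeta hH huM pphi.
have [V2 V2phi] := policy_value_exists hzeta hH huM (phi0_policy m).
pose d0 i := H (i, false) - H (i, true).
pose d1 i := H (i, false) - V1 i; pose d2 i := H (i, false) - V2 i.
have d0B i : `|d0 i| <= 2 * B * zeta ^+ i.
  by apply: (value_diff_le hzeta (G := H)) => x; exact: (H_norm hzeta hH huM x).
have d1B i : `|d1 i| <= 2 * B * zeta ^+ i.
  by apply: (value_diff_le hzeta (G := extend_value H V1)) => x; exact: (extend_value_norm hzeta hH huM x pphi V1phi).
have d2B i : `|d2 i| <= 2 * B * zeta ^+ i.
  by apply: (value_diff_le hzeta (G := extend_value H V2)) => x; exact: (extend_value_norm hzeta hH huM x (phi0_policy m) V2phi).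
pose c1 i := if i%:Z <= kt then d1 i else 0.
pose c2 i := if kt < i%:Z then d2 i else 0.
have zB i : 0 <= 2 * B * zeta ^+ i by have := zi i; nra.
have c1B i : `|c1 i| <= 2 * B * zeta ^+ i by rewrite /c1; case: ifP; rewrite ?normr0.
have c2B i : `|c2 i| <= 2 * B * zeta ^+ i by rewrite /c2; case: ifP; rewrite ?normr0.
rewrite (eq_eseriesr (g := fun i => ((stat_dist m i)%:E * (d1 i)%:E)%E)); last first.
  by move=> i _; rewrite (saved_cost_dirac_value hzeta hH huM _ pphi V1phi).
rewrite [X in (_ <= _ + X)%E](eq_eseriesr (g := fun i => ((stat_dist m i)%:E * (d2 i)%:E)%E)); last first.
  by move=> i _; rewrite (saved_cost_dirac_value hzeta hH huM _ (phi0_policy m) V2phi).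
rewrite (stat_mean_cond _ hzeta d1B) (stat_mean_cond _ hzeta d2B) -EFinD.
rewrite -(stat_meanD hzeta c1B c2B).
apply: le_trans (leeB (opt_saved_cost_le hzeta hH huM) (lexx _)) _.
rewrite -EFinB lee_fin lerBlDr.
(* The loss allowed in each initial state; it remains to show that its stationary mean is at most
   [eps]. *)
pose t i := if i%:Z <= kt then eps / 2 else 2 * B * zeta ^+ i.
have tB i : `|t i| <= (eps / 2 + 2 * B) * zeta ^+ i.
  have e2 : 0 <= eps / 2 by rewrite divr_ge0 // ltW.
  have zi1 : 1 <= zeta ^+ i by rewrite exprn_ege1 // ltW.
  by rewrite /t; case: ifP => _; rewrite ger0_norm //; nra.
pose F i := c1 i + c2 i.
have FB i : `|F i| <= (2 * B + 2 * B) * zeta ^+ i.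
  by rewrite mulrDl (le_trans (ler_normD _ _)) // lerD.
have head i : i%:Z <= kt -> V1 i - H (i, true) <= eps / 2.
  move=> ik; apply: le_trans (greedy_value_le hzeta hH huM htphi i V1phi) _.
  (* A negative [kt] leaves no initial state [i <= kt], so here the integer power of [zeta] is a
     natural one. *)
  have [k ktE] : exists k : nat, kt = k%:Z.
    by exists (absz kt); rewrite gez0_abs // (le_trans _ ik).
  have Kz : 0 < K * zeta ^+ k by rewrite mulr_gt0.
  have x0 : 0 < eps / 2 / 2 * (1 - gam) / (K * zeta ^ kt).
    by rewrite ktE divr_gt0 // !mulr_gt0 // subr_gt0.
  have := expr_log_ceil (b := gam) _ x0; rewrite g0 g1 => /(_ isT).
  rewrite -[absz _]/n ktE ler_pdivlMr // => gn.
  have zik : zeta ^+ i <= zeta ^+ k by rewrite ler_eXn2l // -lez_nat -ktE.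
  rewrite -/gam -/K mulrAC ler_pdivrMr ?subr_gt0 //.
  have gn0 : 0 <= gam ^+ n by rewrite exprn_ge0 // ltW.
  move: (gam ^+ n) gn0 gn => q q0 gn.
  apply: (@le_trans _ _ (2 * K * q * zeta ^+ k)).
    by rewrite ler_wpM2l // mulr_ge0 // mulr_ge0 // ltW.
  rewrite (_ : _ * zeta ^+ k = 2 * (q * (K * zeta ^+ k))); last by ring.
  by rewrite (_ : eps / 2 * _ = 2 * (eps / 2 / 2 * (1 - gam))) ?ler_pM2l //; field.
have tail i : V2 i - H (i, true) <= 2 * B * zeta ^+ i.
  have := extend_value_norm hzeta hH huM (i, true) (phi0_policy m) V2phi.
  have := H_norm hzeta hH huM (i, true).
  rewrite /extend_value /weight /= -/eta -/B !ler_norml => /andP[? ?] /andP[? ?].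
  by lra.
have dF : stat_mean m d0 <= stat_mean m (fun i => F i + t i).
  have FtB i : `|F i + t i| <= (2 * B + 2 * B + (eps / 2 + 2 * B)) * zeta ^+ i.
    by rewrite mulrDl (le_trans (ler_normD _ _)) // lerD.
  apply: (stat_mean_le hzeta d0B FtB) => i; rewrite /F /c1 /c2 /t /d0 /d1 /d2.
  case: (lerP i%:Z kt) => ik; first by have := head i ik; lra.
  by have := tail i; lra.
apply: le_trans dF _; rewrite (stat_meanD hzeta FB tB) lerD2l.
apply: limr_le; first exact: (stat_mean_cvg hzeta tB).
apply: nearW => N.
(* The tail starts no earlier than [k'], also when [kt] is negative and every initial state belongs
   to the tail. *)
pose k' := absz (Num.max 0 kt).
pose x := eps * (1 - eta) * (1 - y) / (4 * uM * (1 - rho m)).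
have x0 : 0 < x by rewrite divr_gt0 // !mulr_gt0 // subr_gt0.
have yk : y ^+ k' <= x by apply: expr_log_ceil; rewrite ?y0.
have k'_le i : kt < i%:Z -> (k' <= i)%N.
  by move=> ki; rewrite -lez_nat gez0_abs ?le_max ?lexx // ge_max /= ltW.
clearbody k'.
have Br : 0 <= 2 * B * (1 - rho m).
  by rewrite mulr_ge0 ?subr_ge0 ?(ltW r1) // mulr_ge0 // ltW.
(* The head bound is extended to all [i], where the total mass one of the stationary distribution
   gives [eps / 2]; the tail bound is extended down to [k']. *)
have split_t i : stat_dist m i * t i <=
    eps / 2 * (1 - rho m) * ((0 <= i)%N%:R * rho m ^+ i)
    + 2 * B * (1 - rho m) * ((k' <= i)%N%:R * y ^+ i).
  rewrite /t /y [(_ * zeta) ^+ i]exprMn /stat_dist leq0n mulr1n mul1r; case: ifP => ik.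
    have : 0 <= 2 * B * (1 - rho m) * ((k' <= i)%N%:R * (rho m ^+ i * zeta ^+ i)).
      by rewrite mulr_ge0 // mulr_ge0 // mulr_ge0 ?(ltW (zi i)) // exprn_ge0 // ltW.
    by lra.
  have -> : (k' <= i)%N by apply: k'_le; rewrite ltNge ik.
  have : 0 <= eps / 2 * (1 - rho m) * rho m ^+ i.
    rewrite mulr_ge0 ?exprn_ge0 ?(ltW r0) // mulr_ge0 ?subr_ge0 ?(ltW r1) //.
    by rewrite divr_ge0 // ltW.
  by rewrite mulr1n mul1r; lra.
rewrite /series /= (le_trans (ler_sum _ (fun i _ => split_t i))) //.
rewrite big_split /= -[X in X + _ <= _]mulr_sumr -[X in _ + X <= _]mulr_sumr.
have rr : 0 <= rho m < 1 by rewrite ltW.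
have yy : 0 <= y < 1 by rewrite ltW.
have h1 := geometric_tail 0 N rr; have h2 := geometric_tail k' N yy.
have b1 : eps / 2 * (1 - rho m) * (\sum_(0 <= i < N) (0 <= i)%N%:R * rho m ^+ i) <= eps / 2.
  rewrite -mulrA -[leRHS]mulr1 ler_wpM2l ?divr_ge0 ?(ltW heps) //.
  by rewrite mulrC -ler_pdivlMr ?subr_gt0 // -(expr0 (rho m)).
have b2 : 2 * B * (1 - rho m) * (\sum_(0 <= i < N) (k' <= i)%N%:R * y ^+ i) <= eps / 2.
  apply: (@le_trans _ _ (2 * B * (1 - rho m) * (x / (1 - y)))).
    rewrite ler_wpM2l //.
    by rewrite (le_trans h2) // ler_wpM2r // invr_ge0 subr_ge0 ltW.
  (* Equality holds: [x], the argument of the logarithm in [ktilde], is exactly the value for which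
     the tail costs [eps / 2]. *)
  rewrite le_eqVlt; apply/orP; left; apply/eqP; rewrite /B /x.
  by field; rewrite !subr_eq0 !(gt_eqF, lt_eqF) // u0.
by apply: le_trans (lerD b1 b2) _; lra.
Qed.
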